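(* Let $A$ be a uniform algebra with compact maximal ideal space $\Phi_A$, and suppose that $A$ has dense invertibles. Then every connected component of every non-empty zero set for $A$ meets the Shilov boundary $\Gamma_A$. That is, for every $f \in A$ with $Z(f) = \{\varphi \in \Phi_A : \varphi(f) = 0\}$ non-empty, and every connected component $K$ of $Z(f)$, we have $K \cap \Gamma_A \neq \emptyset$.
   Context: A uniform algebra on a non-empty compact Hausdorff space $X$ is a uniformly closed, unital subalgebra of $C(X)$ (the continuous complex-valued functions on $X$) that separates the points of $X$; it is a Banach algebra with respect to the uniform norm. $\Phi_A$ is the maximal ideal space (character space, with the Gelfand topology) of $A$; elements of $A$ are regarded as continuous functions on $\Phi_A$ via the Gelfand transform $\hat f(\varphi) = \varphi(f)$. The Shilov boundary $\Gamma_A$ is the minimum non-empty closed subset $K$ of the underlying space $X$ such that $\sup_K |f| = \sup_X |f|$ for all $f \in A$; it is regarded as a subset of $\Phi_A$ by identifying points of $X$ with their evaluation characters (equivalently, it is the minimum non-empty closed subset of $\Phi_A$ on which every $|\hat f|$, $f \in A$, attains its maximum over $\Phi_A$). A unital Banach algebra has dense invertibles if its group of invertible elements is (norm) dense in it. *)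

(* Defs.v *)
From HB Require Import structures.
From mathcomp Require Import all_boot all_order all_algebra.
From mathcomp Require Import complex.
From mathcomp Require Import all_classical all_reals topology normedtype.
Import Order.TTheory GRing.Theory Num.Theory.
Import numFieldNormedType.Exports.
Import ComplexField.Normc.

Set Implicit Arguments.
Unset Strict Implicit.
Unset Printing Implicit Defensive.

Local Open Scope classical_set_scope.
Local Open Scope ring_scope.

(* [R[i]] itself carries no canonical topology; its regular-module alias
   [R[i]^o] carries the one induced by the modulus. *)
Notation cplx R := (R[i]^o) (only parsing).

(* The ring and module operations on [X -> cplx R] are the pointwise ones. *)
Record uniformAlgebra (R : realType) (X : topologicalType) := UniformAlgebra {
  ua_set :> set (X -> cplx R);
  ua_continuous : forall f, ua_set f -> continuous f;
  ua_one : ua_set 1;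
  ua_linear : forall (a : R[i]) f g, ua_set f -> ua_set g -> ua_set (a *: f + g);
  ua_mul : forall f g, ua_set f -> ua_set g -> ua_set (f * g);
  ua_closed : closed (ua_set : set {uniform X -> cplx R});
  ua_separates : forall x y, x <> y -> exists2 f, ua_set f & f x <> f y
}.

Section UniformAlgebra.
Context {R : realType} {X : topologicalType}.
Local Notation C := (cplx R).
Implicit Type A : uniformAlgebra R X.

Record elt A := Elt {
  elt_fun :> X -> C;
  elt_mem : elt_fun \in ua_set A
}.

HB.instance Definition _ A := [isSub for @elt_fun A].
HB.instance Definition _ A := [Choice of elt A by <:].

Lemma ua_subring_closed A : subring_closed (mem (ua_set A)).
Proof.
split=> [|f g|f g]; rewrite !inE; first exact: ua_one.
  by move=> Af Ag; rewrite addrC -scaleN1r; exact: ua_linear.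
exact: ua_mul.
Qed.

Lemma ua_submod_closed A : submod_closed (mem (ua_set A)).
Proof.
split=> [|a f g]; rewrite !inE; last exact: ua_linear.
rewrite -(addNr (1 : X -> C)) -scaleN1r.
by apply: ua_linear; exact: ua_one.
Qed.

HB.instance Definition _ A :=
  GRing.SubChoice_isSubComPzRing.Build (X -> C) _ (elt A) (ua_subring_closed A).
HB.instance Definition _ A :=
  GRing.SubZmodule_isSubLmodule.Build R[i] (X -> C) _ (elt A)
    (ua_submod_closed A).

HB.instance Definition _ A := Uniform.copy (elt A)
  (initial_topology (fun f : elt A => val f : {uniform X -> C})).

Definition dense_invertibles A :=
  dense [set f : elt A | exists g, f * g = 1].

Record character A := Character {
  char_fun :> elt A -> C;
  char_linear : linear char_fun;
  char_monoid : monoid_morphism char_fun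
}.

HB.instance Definition _ A := gen_eqMixin (character A).
HB.instance Definition _ A := gen_choiceMixin (character A).

(* Gelfand topology: the coarsest one making every [phi |-> phi f] continuous. *)
HB.instance Definition _ A := Topological.copy (character A)
  (initial_topology (fun phi : character A => (phi : {ptws elt A -> C}))).

Definition zero_set A (f : elt A) : set (character A) := [set phi | phi f = 0].

Definition ev_fun A (x : X) (f : elt A) : C := val f x.

Lemma ev_linear A x : linear (@ev_fun A x).
Proof. by []. Qed.

Lemma ev_monoid A x : monoid_morphism (@ev_fun A x).
Proof. by []. Qed.

Definition ev A (x : X) : character A :=
  Character (@ev_linear A x) (@ev_monoid A x).

Definition is_boundary A (K : set X) :=
  [/\ K !=set0, closed K &
      forall f : elt A, sup [set normc (val f x) | x in K]
                      = sup [set normc (val f x) | x in setT]].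

(* [get] returns the minimum closed boundary, or [set0] if there is none. *)
Definition shilov_boundary A : set X :=
  get [set K | is_boundary A K /\ forall L, is_boundary A L -> K `<=` L].

End UniformAlgebra.

(* Main.v *)
Require Import Defs.
From HB Require Import structures.
From mathcomp Require Import all_boot all_order all_algebra.
From mathcomp Require Import complex ring lra.
From mathcomp Require Import all_classical all_reals topology normedtype sequences derive.
Import Order.TTheory GRing.Theory Num.Theory.
Import numFieldNormedType.Exports.
Import ComplexField.Normc.

Set Implicit Arguments.
Unset Strict Implicit.
Unset Printing Implicit Defensive.

Local Open Scope classical_set_scope.
Local Open Scope ring_scope.

(**
If a component of [Z(f)] misses the Shilov boundary, it lies in a relatively
clopen part [E] of [Z(f)] that also misses it. Let [O] be an open neighbourhood
of [E] whose closure [T] avoids the boundary and the rest of [Z(f)]. For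
invertible [g] close to [f], [1/g] is larger on [E] than on [T \ O], so a
minimal boundary [B] of the restrictions to [T] contains a point [y] of [O].
Choose [f_i] vanishing at [y] such that the polyhedron [{|f_i| <= 2}] lies in
[O]. Shilov's argument yields [a] in [A] such that [|a|] attains its maximum over
[T] only inside [{|f_i| < 1}].

For [k = a - a(x)], with [x] a maximum point of [|a|], this contradicts the
following replacement for Rossi's local maximum modulus principle, whose proof
uses dense invertibles a second time: a [k] in [A] with a zero in a polyhedron
[{|f_i| <= 2}] has a zero there that lies in the Shilov boundary or satisfies
[|f_i| >= 1] for some [i]. By induction on the number of the [f_i] it suffices
to add one function [f]. If [k] has no zero in the previous polyhedron where
[1 <= |f| <= 2], then [k] and [z - f] generate the unit ideal in the algebra of
Laurent series in [z] on that annulus: [u k + v (z - f) = 1]. The coefficient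
[v_{-1}] satisfies [v_{-1} = 1 - u_+(f) k] for [|f| <= 2] and
[v_{-1} = u_-(f) k] for [|f| >= 1], with [u_+] and [u_-] the two halves of [u].
This survives replacing [k] by a nearby invertible [G], so [v_{-1}/G] is large
near the zeros of [k] inside, and bounded elsewhere independently of [G].
*)

(** * Seminormed algebras and the Gelfand-Mazur theorem *)

Section Normc.
Context {R : realType}.
Implicit Types x y : R[i].

Lemma normr_normc x : `|x| = (normc x)%:C%C.
Proof. by case: x => a b; rewrite normc_def. Qed.

Lemma normc_ge0 x : 0 <= normc x.
Proof. by case: x => a b; exact: sqrtr_ge0. Qed.

Lemma normc_gt0 x : (0 < normc x) = (x != 0).
Proof.
rewrite lt_neqAle normc_ge0 andbT eq_sym; congr (~~ _).
by apply/eqP/eqP => [/eq0_normc|->] //; rewrite normc0.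
Qed.

Lemma normc_real (a : R) : 0 <= a -> normc a%:C%C = a.
Proof. by move=> a0; rewrite /normc /= expr0n /= addr0 sqrtr_sqr ger0_norm. Qed.

Lemma normcX x n : normc (x ^+ n) = normc x ^+ n.
Proof. by elim: n => [|n IH]; rewrite ?expr0 ?normc1// !exprS normcM IH. Qed.

Lemma normc_sqrtc x : normc x = 1 -> exists2 w, w ^+ 2 = x & normc w = 1.
Proof.
move=> x1; exists (sqrtc x); first exact: sqr_sqrtc.
have : normc (sqrtc x) ^+ 2 = 1 by rewrite -normcX sqr_sqrtc.
move=> /eqP; rewrite sqrp_eq1 ?normc_ge0//; by move=> /eqP.
Qed.

End Normc.

Record is_seminorm (R : realType) (L : comNzRingType)
    (io : {rmorphism R[i] -> L}) (q : L -> R) : Prop := IsSeminorm {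
  seminorm_ge0 : forall x, 0 <= q x;
  seminormD : forall x y, q (x + y) <= q x + q y;
  seminormM : forall x y, q (x * y) <= q x * q y;
  seminorm_scalar : forall c, q (io c) <= normc c;
  seminorm1 : 1 <= q 1 }.

Section SeminormTheory.
Context {R : realType} {L : comNzRingType} {io : {rmorphism R[i] -> L}}.
Context {q : L -> R} (Hq : is_seminorm io q).

Lemma seminorm_eq1 : q 1 = 1.
Proof.
apply/eqP; rewrite eq_le (seminorm1 Hq) andbT -(rmorph1 io) -(normc1 R).
exact: (seminorm_scalar Hq).
Qed.

Lemma seminorm0 : q 0 = 0.
Proof.
apply/eqP; rewrite eq_le -{1}(rmorph0 io) -{1}(normc0 R) (seminorm_scalar Hq) /=.
have := seminormD Hq 0 1; rewrite add0r; lra.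
Qed.

Lemma seminormZ_le c x : q (io c * x) <= normc c * q x.
Proof.
apply: le_trans (seminormM Hq _ _) _.
by apply: ler_wpM2r; [exact: (seminorm_ge0 Hq)|exact: (seminorm_scalar Hq)].
Qed.

Lemma seminormN x : q (- x) = q x.
Proof.
have qN y : q (- y) <= q y.
  by have := seminormZ_le (-1) y; rewrite normcN normc1 rmorphN rmorph1 mul1r mulN1r.
by apply/eqP; rewrite eq_le qN /= -{1}(opprK x) qN.
Qed.

Lemma seminormB x y : q (x - y) <= q x + q y.
Proof. by rewrite -(seminormN y); exact: (seminormD Hq). Qed.

Lemma seminormX x n : q (x ^+ n) <= q x ^+ n.
Proof.
elim: n => [|n IH]; first by rewrite !expr0 seminorm_eq1.
rewrite !exprS; apply: le_trans (seminormM Hq _ _) _.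
by rewrite ler_wpM2l ?(seminorm_ge0 Hq).
Qed.

Lemma seminorm_geometric e (n : nat) : q e < 1 ->
  q (\sum_(j < n) e ^+ j) <= (1 - q e)^-1.
Proof.
move=> e1; have e0 := seminorm_ge0 Hq e.
suff : q (\sum_(j < n) e ^+ j) <= (1 - q e ^+ n) / (1 - q e).
  move=> /le_trans; apply; rewrite ler_pdivrMr ?subr_gt0// mulVf ?gt_eqF ?subr_gt0//.
  by rewrite gerBl exprn_ge0.
elim: n => [|n IH]; first by rewrite big_ord0 seminorm0 expr0 subrr mul0r.
rewrite big_ord_recr /=; apply: le_trans (seminormD Hq _ _) _.
have -> : (1 - q e ^+ n.+1) / (1 - q e) = (1 - q e ^+ n) / (1 - q e) + q e ^+ n.
  by rewrite exprS; field; lra.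
by rewrite lerD// seminormX.
Qed.

Lemma mul_geometric (e : L) n : (1 - e) * (\sum_(j < n) e ^+ j) = 1 - e ^+ n.
Proof.
rewrite -(expr1n _ n) subrXX expr1n; congr (_ * _).
by apply: eq_bigr => i _; rewrite expr1n mul1r.
Qed.

(** Completeness is not assumed, so Neumann series need not converge. Exact inverses are replaced by
    inverses up to every positive error, with one bound [M] for all errors. *)
Definition approx_inv M x :=
  forall e, 0 < e -> exists y, q y <= M /\ q (1 - x * y) <= e.

Lemma approx_invW M M' x : M <= M' -> approx_inv M x -> approx_inv M' x.
Proof.
move=> MM' Mx e e0; have [y [yM ye]] := Mx e e0.
by exists y; split=> //; exact: le_trans yM MM'.
Qed.

Lemma exists_expr_le (a e : R) : 0 <= a < 1 -> 0 < e -> exists n, a ^+ n <= e.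
Proof.
move=> /andP[a0 a1] e0.
have /cvgrPdist_le /(_ e e0)[n _ /(_ n (leqnn _))] : (GRing.exp a @ \oo --> (0:R)).
  by apply: cvg_expr; rewrite ger0_norm.
by rewrite sub0r normrN ger0_norm ?exprn_ge0// => ?; exists n.
Qed.

(** Truncated Neumann series: with [e = 1 - x * u], the element [u * (1 + e + ... + e^(n-1))]
    inverts [x] up to [e^n]. *)
Lemma approx_inv_intro x u : q (1 - x * u) < 1 ->
  approx_inv (q u / (1 - q (1 - x * u))) x.
Proof.
set e := 1 - x * u => e1 d d0.
have [n en] : exists n, q e ^+ n <= d by apply: exists_expr_le; rewrite ?(seminorm_ge0 Hq).
exists (u * \sum_(j < n) e ^+ j); split.
  apply: le_trans (seminormM Hq _ _) _.
  by rewrite ler_wpM2l ?(seminorm_ge0 Hq) ?seminorm_geometric.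
have -> : x * (u * \sum_(j < n) e ^+ j) = 1 - e ^+ n.
  by rewrite -mul_geometric mulrA; congr (_ * _); rewrite /e; ring.
rewrite opprB addrC subrK; exact: le_trans (seminormX _ _) en.
Qed.

(** An inverse of [x] up to 1/4 inverts [x'] up to 1/2, and the Neumann series then at most doubles
    the bound. *)
Lemma approx_inv_near M x x' : 0 < M -> approx_inv M x -> q (x' - x) <= (4 * M)^-1 ->
  approx_inv (2 * M) x'.
Proof.
move=> M0 Mx xx'; have [|y [yM ye]] := Mx 4^-1; first by lra.
have e2 : q (1 - x' * y) <= 2^-1.
  have -> : 1 - x' * y = (1 - x * y) - (x' - x) * y by ring.
  apply: le_trans (seminormB _ _) _.
  suff : q ((x' - x) * y) <= 4^-1 by lra.
  apply: le_trans (seminormM Hq _ _) _.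
  have -> : 4^-1 = (4 * M)^-1 * M by field; lra.
  by apply: ler_pM; rewrite ?(seminorm_ge0 Hq).
apply: (approx_invW _ (@approx_inv_intro x' y _)); last by lra.
rewrite ler_pdivrMr; last by lra.
by have := seminorm_ge0 Hq y; nra.
Qed.

End SeminormTheory.

Section GelfandMazur.
Context {R : realType} {L : comNzRingType} {io : {rmorphism R[i] -> L}}.
Context {q : L -> R} (Hq : is_seminorm io q).
Local Notation approx_inv := (@approx_inv R L q).

Lemma normc_Complex_le (a b : R) : normc (Complex a b) <= `|a| + `|b|.
Proof.
have -> : Complex a b = a%:C%C + 'i%C * b%:C%C.
  by apply/eqP; rewrite eq_complex /=; apply/andP; split; apply/eqP; ring.
apply: le_trans (le_normcD _ _) _; rewrite normcM.
have -> : normc 'i%C = 1 :> R by rewrite /normc /= expr0n expr1n add0r sqrtr1.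
have normcR (x : R) : normc x%:C%C = `|x| by rewrite /normc /= expr0n addr0 sqrtr_sqr.
by rewrite mul1r !normcR.
Qed.

Lemma normc_Re (z : R[i]) : `|complex.Re z| <= normc z.
Proof.
case: z => a b /=; rewrite -(sqrtr_sqr a) ler_wsqrtr// lerDl sqr_ge0//.
Qed.

Lemma normc_Im (z : R[i]) : `|complex.Im z| <= normc z.
Proof.
case: z => a b /=; rewrite -(sqrtr_sqr b) ler_wsqrtr// lerDr sqr_ge0//.
Qed.

(** A bound at one [mu] persists, doubled, on a neighbourhood. Compactness of a square containing
    the disc makes it uniform. *)
Lemma approx_inv_uniform (h : L) (T : R) :
  (forall mu, exists M, approx_inv M (1 - io mu * h)) ->
  exists2 M, 0 < M & forall mu, normc mu <= T -> approx_inv M (1 - io mu * h).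
Proof.
move=> inv.
have cpt : compact (`[-T, T]%classic `*` `[-T, T]%classic : set (R * R)).
  by apply: compact_setX; exact: segment_compact.
have near : \forall M \near +oo, (`[-T, T]%classic `*` `[-T, T]%classic) `<=`
     (fun ab : R * R => approx_inv M (1 - io (Complex ab.1 ab.2) * h)).
  move/compact_near_coveringP : cpt; apply=> -[a b] _ /=.
  have [M0 inv0] := inv (Complex a b).
  pose M := Num.max M0 1.
  have M_gt0 : 0 < M by rewrite lt_max ltr01 orbT.
  have invM : approx_inv M (1 - io (Complex a b) * h).
    by apply: approx_invW inv0; rewrite le_max lexx.
  have qh := seminorm_ge0 Hq h.
  (* Each real coordinate moves by less than [d], so [mu] moves by at most [2 * d], and
     [2 * d * (q h + 1)] is exactly the tolerance [(4 * M)^-1]. *)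
  pose d := (8 * M * (q h + 1))^-1.
  have d_gt0 : 0 < d by rewrite invr_gt0; nra.
  exists (ball (a, b) d, [set M' | 2 * M < M']).
    split => /=; first exact: nbhsx_ballx.
    by exists (2 * M); split => //; exact: num_real.
  move=> [[a' b'] M'] /= [[/= ha hb] MM'].
  apply: (@approx_invW _ _ _ (2 * M)); first exact: ltW.
  apply: (approx_inv_near Hq M_gt0 invM) => /=.
  have -> : 1 - io (Complex a' b') * h - (1 - io (Complex a b) * h) =
            io (Complex (a - a') (b - b')) * h.
    have -> : Complex (a - a') (b - b') = Complex a b - Complex a' b' by [].
    by rewrite rmorphB; ring.
  apply: le_trans (seminormZ_le Hq _ _) _.
  have lt1 : normc (Complex (a - a') (b - b')) <= 2 * d.
    apply: le_trans (normc_Complex_le _ _) _.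
    move: ha hb; rewrite /ball /= => ha hb; lra.
  apply: (@le_trans _ _ (2 * d * q h)); first by rewrite ler_wpM2r.
  have -> : (4 * M)^-1 = 2 * d * (q h + 1) by rewrite /d; field; lra.
  by rewrite ler_wpM2l; lra.
have [M [M_gt0 HM]] : exists M, 0 < M /\ ((`[-T, T]%classic `*` `[-T, T]%classic) `<=`
     (fun ab : R * R => approx_inv M (1 - io (Complex ab.1 ab.2) * h))).
  have [M [HM M_gt0]] := filter_ex (filterI near (nbhs_pinfty_gt (num_real (0 : R)))).
  by exists M.
exists M => // mu muT; have /= := HM (complex.Re mu, complex.Im mu).
rewrite !in_itv /= -!ler_norml; case: mu muT => a b ab; apply; split.
  exact: le_trans (normc_Re (Complex a b)) ab.
exact: le_trans (normc_Im (Complex a b)) ab.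
Qed.

(** The resolvents [1/(1 - w z1)] and [1/(1 - w z2)] are bounded by [M] and [t]-close, with [M] and
    [t] uniform in [w] on the unit circle. *)
Definition close_inv (M t : R) (z1 z2 : L) :=
  forall w, normc w = 1 -> forall e, 0 < e -> exists y1 y2,
   [/\ q y1 <= M, q y2 <= M, q (1 - (1 - io w * z1) * y1) <= e,
       q (1 - (1 - io w * z2) * y2) <= e & q (y1 - y2) <= t].

Lemma half_io : io 2^-1 * 2 = 1 :> L.
Proof. by rewrite -(rmorph_nat io 2) -rmorphM mulVf ?rmorph1// pnatr_eq0. Qed.

Lemma normc_half : normc (2^-1 : R[i]) = 2^-1.
Proof.
have -> : (2^-1 : R[i]) = (2^-1 : R)%:C%C by rewrite fmorphV rmorph_nat.
by rewrite normc_real// invr_ge0.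
Qed.

Lemma seminorm_half x y (B : R) : q x <= B -> q y <= B -> q (io 2^-1 * (x + y)) <= B.
Proof.
move=> xB yB; apply: le_trans (seminormZ_le Hq _ _) _.
rewrite normc_half; have := seminormD Hq x y; lra.
Qed.

(* Partial fractions: [1/(1 - w z^2)] is the mean of [1/(1 - v z)] and
   [1/(1 + v z)], where [v^2 = w]; bounds that are uniform over the unit
   circle therefore survive squaring. *)
Lemma close_inv_sqr M t z1 z2 : close_inv M t z1 z2 -> close_inv M t (z1 ^+ 2) (z2 ^+ 2).
Proof.
move=> H w w1 e e0; have [v v2 nv] := normc_sqrtc w1.
have q1 := seminorm_ge0 Hq z1; have q2 := seminorm_ge0 Hq z2.
pose B := 1 + q z1 + q z2; pose e' := e / B.
have B0 : 0 < B by rewrite /B; lra.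
have e'0 : 0 < e' by rewrite divr_gt0.
have [y1 [y2 [b1 b2 i1 i2 c]]] := H v nv e' e'0.
have nNv : normc (- v) = 1 by rewrite normcN.
have [u1 [u2 [b1' b2' i1' i2' c']]] := H (- v) nNv e' e'0.
exists (io 2^-1 * (y1 + u1)), (io 2^-1 * (y2 + u2)).
have key z y u : q z <= q z1 + q z2 -> q (1 - (1 - io v * z) * y) <= e' ->
    q (1 - (1 - io (- v) * z) * u) <= e' ->
    q (1 - (1 - io w * z ^+ 2) * (io 2^-1 * (y + u))) <= e.
  move=> zB iy iu.
  (* Since [1 - w z^2 = (1 - v z)(1 + v z)], each of the two errors gets multiplied by the
     complementary factor, whose seminorm is at most [B]. *)
  have -> : 1 - (1 - io w * z ^+ 2) * (io 2^-1 * (y + u)) =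
    io 2^-1 * ((1 + io v * z) * (1 - (1 - io v * z) * y)
               + (1 - io v * z) * (1 - (1 - io (- v) * z) * u)).
    rewrite -v2 rmorphN rmorphXn /=.
    transitivity (io 2^-1 * 2 - (1 - io v ^+ 2 * z ^+ 2) * (io 2^-1 * (y + u))).
      by rewrite half_io.
    by ring.
  have vz : q (io v * z) <= q z.
    by apply: le_trans (seminormZ_le Hq _ _) _; rewrite nv mul1r.
  have Be : B * e' = e by rewrite /e'; field; rewrite gt_eqF.
  have q11 := seminorm_eq1 Hq.
  apply: seminorm_half; rewrite -Be; apply: le_trans (seminormM Hq _ _) _;
    apply: ler_pM; rewrite ?(seminorm_ge0 Hq)//.
    by apply: le_trans (seminormD Hq _ _) _; rewrite /B; lra.
  by apply: le_trans (seminormB Hq _ _) _; rewrite /B; lra.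
split; [exact: seminorm_half|exact: seminorm_half| | |].
- by apply: key => //; lra.
- by apply: key => //; lra.
have -> : io 2^-1 * (y1 + u1) - io 2^-1 * (y2 + u2) = io 2^-1 * ((y1 - y2) + (u1 - u2)) by ring.
exact: seminorm_half.
Qed.

Lemma close_inv_pow M t z1 z2 s : close_inv M t z1 z2 ->
  close_inv M t (z1 ^+ (2 ^ s)%N) (z2 ^+ (2 ^ s)%N).
Proof.
move=> H; elim: s => [|s IH]; first by rewrite expn0 !expr1.
by rewrite expnSr !exprM; exact: close_inv_sqr.
Qed.

(** Resolvent identity: [1/x1 - 1/x2 = (x2 - x1)/(x1 x2)], where [x2 - x1] has seminorm at most
    [(b - a) * q h]. *)
Lemma close_inv_start M h a b t : 0 < M ->
  (forall mu, normc mu <= b -> approx_inv M (1 - io mu * h)) ->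
  0 <= a <= b -> M ^+ 2 * q h * (b - a) < t ->
  close_inv M t (io a%:C%C * h) (io b%:C%C * h).
Proof.
move=> M0 inv /andP[a0 ab] Ht w w1 e e0.
(* The strict inequality assumed for [t] leaves room for two inversion errors, each multiplied by at
   most [M]. *)
pose d := Num.min e ((t - M ^+ 2 * q h * (b - a)) / (2 * M)).
have d0 : 0 < d by rewrite lt_min e0 divr_gt0//; nra.
have de : d <= e by rewrite /d ge_min lexx.
have dt : 2 * M * d <= t - M ^+ 2 * q h * (b - a).
  have : d <= (t - M ^+ 2 * q h * (b - a)) / (2 * M) by rewrite /d ge_min lexx orbT.
  by rewrite ler_pdivlMr; [rewrite mulrC|nra].
have inv' c : 0 <= c <= b -> approx_inv M (1 - io w * (io c%:C%C * h)).
  move=> /andP[c0 cb]; rewrite mulrA -rmorphM; apply: inv.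
  by rewrite normcM w1 mul1r normc_real.
have [|y1 [b1 i1]] := inv' a _ d d0; first by rewrite a0.
have [|y2 [b2 i2]] := inv' b _ d d0; first by rewrite lexx andbT; lra.
exists y1, y2; split=> //; try by lra.
set x1 := 1 - io w * (io a%:C%C * h) in i1 *.
set x2 := 1 - io w * (io b%:C%C * h) in i2 *.
have -> : y1 - y2 = y1 * (1 - x2 * y2) - y2 * (1 - x1 * y1) + (x2 - x1) * (y1 * y2) by ring.
have p1 : q (y1 * (1 - x2 * y2)) <= M * d.
  by apply: le_trans (seminormM Hq _ _) _; rewrite ler_pM// (seminorm_ge0 Hq).
have p2 : q (y2 * (1 - x1 * y1)) <= M * d.
  by apply: le_trans (seminormM Hq _ _) _; rewrite ler_pM// (seminorm_ge0 Hq).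
have p3 : q (y1 * y2) <= M ^+ 2.
  by apply: le_trans (seminormM Hq _ _) _; rewrite expr2 ler_pM// (seminorm_ge0 Hq).
have p4 : q (x2 - x1) <= (b - a) * q h.
  have -> : x2 - x1 = io (- (w * (b - a)%:C%C)) * h.
    by rewrite rmorphN rmorphM rmorphB rmorphB /x2 /x1; ring.
  apply: le_trans (seminormZ_le Hq _ _) _.
  by rewrite normcN normcM w1 mul1r normc_real// subr_ge0.
have p5 : q ((x2 - x1) * (y1 * y2)) <= (b - a) * q h * M ^+ 2.
  by apply: le_trans (seminormM Hq _ _) _; rewrite ler_pM// (seminorm_ge0 Hq).
have := seminormD Hq (y1 * (1 - x2 * y2) - y2 * (1 - x1 * y1)) ((x2 - x1) * (y1 * y2)).
have := seminormB Hq (y1 * (1 - x2 * y2)) (y2 * (1 - x1 * y1)).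
lra.
Qed.

Definition inv_near1 x := forall e, 0 < e ->
  exists y, q (1 - x * y) <= e /\ q (y - 1) <= 4^-1.

(** For the inverses [y1] of [1 - r Z] and [y2] of [1 - Z] one has [(1 - r)(y2 - 1) y1 = y2 - y1],
    up to small errors. As [y1] is near 1, [r <= 1/4] and [y2 - y1] is at most 1/10, the distance of
    [y2] from 1 is again at most 1/4. The step thus reproduces its own hypothesis. *)
Lemma inv_near1_step M (r : R) Z : 0 < M -> 0 <= r <= 4^-1 ->
  close_inv M 10^-1 (io r%:C%C * Z) Z -> inv_near1 (1 - io r%:C%C * Z) -> inv_near1 (1 - Z).
Proof.
move=> M0 /andP[r0 r4] H near1 e0 e00.
pose e := Num.min e0 (100 * (M + 2))^-1.
have e_gt0 : 0 < e by rewrite lt_min e00 invr_gt0; nra.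
have ee0 : e <= e0 by rewrite ge_min lexx.
have eM : (M + 2) * e <= 100^-1.
  have : e <= (100 * (M + 2))^-1 by rewrite ge_min lexx orbT.
  rewrite -ler_pdivlMl; last by lra.
  by move=> /le_trans; apply; rewrite invfM mulrC.
have [y1 [y2 [b1 b2 i1 i2 c]]] := H 1 (normc1 _) e e_gt0.
move: i1 i2; rewrite rmorph1 !mul1r; set x1 := 1 - io _ * Z; set x2 := 1 - Z => i1 i2.
have [y [iy y1']] := near1 e e_gt0; rewrite -/x1 in iy.
exists y2; split; first by lra.
have qy : q y <= 5 / 4.
  have -> : y = (y - 1) + 1 by ring.
  by have := seminormD Hq (y - 1) 1; rewrite (seminorm_eq1 Hq); lra.
have d1 : q (1 - y1) <= 4^-1 + 100^-1.
  have -> : 1 - y1 = (y * (1 - x1 * y1) - y1 * (1 - x1 * y)) - (y - 1) by ring.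
  have p1 : q (y * (1 - x1 * y1)) <= 5 / 4 * e.
    by apply: le_trans (seminormM Hq _ _) _; rewrite ler_pM// (seminorm_ge0 Hq).
  have p2 : q (y1 * (1 - x1 * y)) <= M * e.
    by apply: le_trans (seminormM Hq _ _) _; rewrite ler_pM// (seminorm_ge0 Hq).
  have := seminormB Hq (y * (1 - x1 * y1) - y1 * (1 - x1 * y)) (y - 1).
  have := seminormB Hq (y * (1 - x1 * y1)) (y1 * (1 - x1 * y)).
  by lra.
pose g := (1 - r)%:C%C; have g34 : 3 / 4 <= 1 - r by lra.
have d2 : (1 - r) * q ((y2 - 1) * y1) <= 10^-1 + 3 * (M * e).
  have p1 : q (y2 * (1 - x1 * y1)) <= M * e.
    by apply: le_trans (seminormM Hq _ _) _; rewrite ler_pM// (seminorm_ge0 Hq).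
  have p2 : q (y1 * (1 - x2 * y2)) <= M * e.
    by apply: le_trans (seminormM Hq _ _) _; rewrite ler_pM// (seminorm_ge0 Hq).
  have p3 : q (io g * (y1 * (1 - x2 * y2))) <= M * e.
    apply: le_trans (seminormZ_le Hq _ _) _.
    rewrite normc_real; last by lra.
    have := seminorm_ge0 Hq (y1 * (1 - x2 * y2)); nra.
  have E : io g * ((y2 - 1) * y1) = (y2 - y1) - (y2 * (1 - x1 * y1))
      + (y1 * (1 - x2 * y2)) - io g * (y1 * (1 - x2 * y2)).
    by rewrite /g rmorphB rmorph1 rmorphB rmorph1 /x1 /x2; ring.
  have p4 : (1 - r) * q ((y2 - 1) * y1) <= q (io g * ((y2 - 1) * y1)).
    have := seminormZ_le Hq g^-1 (io g * ((y2 - 1) * y1)).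
    have g0 : g != 0.
      by rewrite /g fmorph_eq0; lra.
    rewrite mulrA -rmorphM mulVf// rmorph1 mul1r normcV normc_real; last by lra.
    by rewrite ler_pdivlMl//; lra.
  apply: le_trans p4 _; rewrite E.
  have := seminormB Hq ((y2 - y1) - (y2 * (1 - x1 * y1)) + (y1 * (1 - x2 * y2)))
      (io g * (y1 * (1 - x2 * y2))).
  have := seminormD Hq ((y2 - y1) - (y2 * (1 - x1 * y1))) (y1 * (1 - x2 * y2)).
  have := seminormB Hq (y2 - y1) (y2 * (1 - x1 * y1)).
  by move: c; rewrite -(seminormN Hq (y1 - y2)) opprB; lra.
have d3 : q ((y2 - 1) * (1 - y1)) <= q (y2 - 1) * (4^-1 + 100^-1).
  apply: le_trans (seminormM Hq _ _) _; rewrite ler_wpM2l// (seminorm_ge0 Hq)//.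
have : q (y2 - 1) <= q ((y2 - 1) * y1) + q ((y2 - 1) * (1 - y1)).
  apply: le_trans (seminormD Hq _ _).
  by have -> : (y2 - 1) * y1 + (y2 - 1) * (1 - y1) = y2 - 1 by ring.
have := seminorm_ge0 Hq ((y2 - 1) * y1); have := seminorm_ge0 Hq (y2 - 1).
by nra.
Qed.

(** For [n = 2^s], the mean of [1/(1 - w t h)] over the n-th roots of unity [w] is
    [1/(1 - (t h)^n)]; such means replace the Cauchy integral. As [t] goes from 0 to [T] in small
    steps, this inverse stays within 1/4 of 1. At [t = T] this is impossible, because multiplication
    by [T h] expands the seminorm. *)
Theorem seminormed_Gelfand_Mazur (h : L) :
  (forall l, exists u, q (1 - u * (h - io l)) < 1) -> False.
Proof.
move=> inv.
have inv' mu : exists M, approx_inv M (1 - io mu * h).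
  have [->|mu0] := eqVneq mu 0.
    rewrite rmorph0 mul0r subr0; eexists; apply: (approx_inv_intro Hq (u := 1)).
    by rewrite mulr1 subrr (seminorm0 Hq).
  have [u Hu] := inv mu^-1.
  eexists; apply: (approx_inv_intro Hq (u := - u * io mu^-1)).
  have -> : (1 - io mu * h) * (- u * io mu^-1) = u * (io mu * io mu^-1 * h - io mu^-1) by ring.
  by rewrite -rmorphM divff// rmorph1 mul1r.
have [v vh] : exists v, q (1 - v * h) <= 2^-1.
  have [u Hu] := inv 0; rewrite rmorph0 subr0 mulrC in Hu.
  have [|v [_ ?]] := approx_inv_intro Hq Hu (e := 2^-1); first by rewrite invr_gt0.
  by exists v; rewrite mulrC.
(* As [v] inverts [h] up to 1/2, this [T] makes multiplication by [T * h] at least double the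
   seminorm. *)
pose T := 4 * (q v + 1); have qv := seminorm_ge0 Hq v.
have TE : T = 4 * (q v + 1) by [].
have T0 : 0 < T by rewrite /T; lra.
clearbody T.
have hlow x : q x <= 2 * q v * q (h * x).
  have := seminormD Hq (v * (h * x)) ((1 - v * h) * x).
  have := seminormM Hq v (h * x); have := seminormM Hq (1 - v * h) x.
  have -> : v * (h * x) + (1 - v * h) * x = x by ring.
  by have := seminorm_ge0 Hq x; have := seminorm_ge0 Hq (h * x); nra.
have [M M0 HM] := approx_inv_uniform T inv'.
have qh := seminorm_ge0 Hq h.
(* So many steps that consecutive resolvents differ by less than 1/10. *)
pose N := (Num.truncn (20 * M ^+ 2 * q h * T)).+1.
have N0 : 0 < N%:R :> R by rewrite ltr0n.
have HN : M ^+ 2 * q h * (T / N%:R) < 10^-1.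
  have : 20 * M ^+ 2 * q h * T < N%:R by apply: truncnS_gt.
  move=> HN; have -> : M ^+ 2 * q h * (T / N%:R) = M ^+ 2 * q h * T / N%:R by ring.
  by rewrite ltr_pdivrMr//; lra.
pose t i : R := T * i%:R / N%:R.
(* After raising to the power [2^s], consecutive points of the chain have ratio at most 1/4, whereas
   the closeness 1/10 of the resolvents is unaffected by repeated squaring. *)
have [s Hs] : exists s, (N%:R / N.+1%:R) ^+ (2 ^ s)%N <= 4^-1 :> R.
  have [||n Hn] := @exists_expr_le R (N%:R / N.+1%:R) 4^-1.
  - by rewrite divr_ge0 ?ler0n//= ltr_pdivrMr ?ltr0n// mul1r ltr_nat.
  - by rewrite invr_gt0.
  exists n; apply: le_trans Hn; apply: ler_wiXn2l; last exact/ltnW/ltn_expl.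
    by rewrite divr_ge0 ?ler0n.
  by rewrite ler_pdivrMr ?ltr0n// mul1r ler_nat.
pose z i := (io (t i)%:C%C * h) ^+ (2 ^ s)%N.
have tle i : (i <= N)%N -> 0 <= t i <= T.
  move=> iN; rewrite /t; apply/andP; split.
    by rewrite divr_ge0 ?mulr_ge0 ?ler0n ?(ltW T0).
  by rewrite ler_pdivrMr// ler_pM2l// ler_nat.
have chain : forall k, (k <= N)%N -> inv_near1 (1 - z k).
  elim=> [_|j IH iN].
    move=> e e0; exists 1; rewrite /z /t mulr0 mul0r rmorph0 mul0r.
    rewrite expr0n expn_eq0 /= subr0 mulr1 subrr (seminorm0 Hq); split; first exact: ltW.
    by rewrite invr_ge0.
  pose r : R := (j%:R / j.+1%:R) ^+ (2 ^ s)%N.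
  have Er : z j = io r%:C%C * z j.+1.
    rewrite /z !exprMn mulrA -!rmorphXn -rmorphM -rmorphM /r; congr (io (_%:C%C) * _).
    rewrite -exprMn; congr (_ ^+ _).
    have gen (a b n : R) : b != 0 -> n != 0 -> T * a / n = a / b * (T * b / n).
      by move=> b0 n0; field; rewrite b0 n0.
    by rewrite /t; apply: gen; rewrite pnatr_eq0.
  have r4 : 0 <= r <= 4^-1.
    rewrite exprn_ge0 ?divr_ge0 ?ler0n//=; apply: le_trans Hs.
    rewrite lerXn2r ?nnegrE ?divr_ge0 ?ler0n// ler_pdivrMr ?ltr0n// mulrAC ler_pdivlMr ?ltr0n//.
    by rewrite -!natrM ler_nat !mulnS (mulnC j) leq_add2r ltnW.
  apply: (@inv_near1_step M r) => //; last by rewrite -Er; apply: IH; exact: ltnW.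
  rewrite -Er; apply: close_inv_pow; apply: close_inv_start => //.
  - by move=> mu Hmu; apply: HM; have /andP[_] := tle _ iN; exact: le_trans.
  - have /andP[-> _] /= := tle j (ltnW iN).
    by rewrite /t ler_wpM2r ?invr_ge0 ?ler0n// ler_wpM2l ?(ltW T0)// ler_nat.
  - by have -> : t j.+1 - t j = T / N%:R by rewrite /t -natr1; field; lra.
have tN : t N = T by rewrite /t; field; lra.
have [|y [i1 i2]] := chain N (leqnn N) 4^-1; first by rewrite invr_gt0.
have lowT x : 2 * q x <= q (io T%:C%C * h * x).
  have := hlow x; have := seminormZ_le Hq T%:C%C^-1 (io T%:C%C * h * x).
  rewrite -mulrA [X in q X <= _]mulrA -rmorphM mulVf; last by rewrite fmorph_eq0; lra.
  rewrite rmorph1 mul1r normcV normc_real; last by lra.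
  rewrite ler_pdivlMl// => H1 H2.
  have := seminorm_ge0 Hq (h * x); nra.
have lowTn n x : q x <= q ((io T%:C%C * h) ^+ n * x).
  elim: n => [|n IH]; first by rewrite expr0 mul1r.
  rewrite exprS -mulrA; have := lowT ((io T%:C%C * h) ^+ n * x).
  by have := seminorm_ge0 Hq ((io T%:C%C * h) ^+ n * x); lra.
have low : 2 * q y <= q (z N * y).
  rewrite /z tN; have := lowTn (2 ^ s).-1 (io T%:C%C * h * y).
  rewrite mulrA -exprSr prednK ?expn_gt0//.
  by have := lowT y; lra.
(* Since [y] is within 1/4 of 1, the expansion bound gives [q (z N * y) >= 2 * q y >= 3/2], which
   contradicts this estimate. *)
have : q (z N * y) <= 2^-1.
  have -> : z N * y = (y - 1) + (1 - (1 - z N) * y) by ring.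
  by have := seminormD Hq (y - 1) (1 - (1 - z N) * y); lra.
have : 1 <= q y + q (y - 1).
  have := seminormB Hq y (y - 1); rewrite opprB addrC subrK (seminorm_eq1 Hq); lra.
lra.
Qed.

End GelfandMazur.

(** * Existence of characters *)

Record contractive_char (R : realType) (L : comNzRingType)
    (io : {rmorphism R[i] -> L}) (q : L -> R) (psi : L -> R[i]) : Prop := {
  charD : forall x y, psi (x + y) = psi x + psi y;
  charM : forall x y, psi (x * y) = psi x * psi y;
  char_scalar : forall c, psi (io c) = c;
  char_le : forall x, normc (psi x) <= q x }.

Section Characters.
Context {R : realType} {L : comNzRingType} {io : {rmorphism R[i] -> L}}.
Context {q : L -> R} (Hq : is_seminorm io q).

(** A proper ideal may be dense here. Distance at least 1 from the unit passes to unions of chains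
    and keeps the quotient seminorm of 1 at least 1. *)
Record far_ideal (J : set L) : Prop := FarIdeal {
  ideal0 : J 0;
  idealD : forall x y, J x -> J y -> J (x + y);
  idealM : forall x y, J x -> J (y * x);
  ideal_far : forall x, J x -> 1 <= q (1 - x) }.

Lemma maximal_far_ideal (J : set L) : far_ideal J ->
  exists M, [/\ far_ideal M, J `<=` M &
    forall B, far_ideal B -> M `<=` B -> B `<=` M].
Proof.
(* [set0] is admitted because [Zorn_bigcup] also applies to the empty chain. *)
move=> HJ; pose P B := B = set0 \/ (far_ideal B /\ J `<=` B).
have [|M [PM maxM]] := @Zorn_bigcup L P.
  move=> F FP Ftot.
  have [[B0 FB0 [b0 B0b0]]|nF] := pselect (exists2 B, F B & B !=set0); last first.
    left; apply/seteqP; split=> // x [B FB Bx].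
    by apply: nF; exists B => //; exists x.
  have FI B : F B -> B !=set0 -> far_ideal B /\ J `<=` B.
    by move=> /FP[->|//] [].
  have [I0 J0] := FI _ FB0 (ex_intro _ _ B0b0).
  right; split; last by move=> x /J0 B0x; exists B0.
  split.
  - by exists B0 => //; exact: (ideal0 I0).
  - move=> x y [B FB Bx] [C FC Cy].
    have [IB _] := FI _ FB (ex_intro _ _ Bx).
    have [IC _] := FI _ FC (ex_intro _ _ Cy).
    by have [BC|CB] := Ftot _ _ FB FC;
      [exists C => //; apply: (idealD IC) => //; exact: BC
      |exists B => //; apply: (idealD IB) => //; exact: CB].
  - move=> x y [B FB Bx]; exists B => //.
    by have [IB _] := FI _ FB (ex_intro _ _ Bx); exact: (idealM IB).
  - move=> x [B FB Bx].
    by have [IB _] := FI _ FB (ex_intro _ _ Bx); exact: (ideal_far IB).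
case: PM => [M0|[IM JM]].
  exfalso; apply: (maxM J); last by right; split.
  by rewrite M0; split=> [x []|H]; exact: (H 0 (ideal0 HJ)).
exists M; split=> // B IB MB; apply: contrapT => nBM.
by apply: (maxM B) => //; right; split=> //; exact: subset_trans MB.
Qed.

Definition quotient_norm (M : set L) x := inf [set q (x - m) | m in M].

Lemma quotient_norm_le M x m : M m -> quotient_norm M x <= q (x - m).
Proof.
move=> Mm; apply: ge_inf; last by exists m.
by exists 0 => _ [n _ <-]; exact: (seminorm_ge0 Hq).
Qed.

Lemma le_quotient_norm M x a : M !=set0 -> (forall m, M m -> a <= q (x - m)) ->
  a <= quotient_norm M x.
Proof.
move=> [m0 Mm0] H; apply: lb_le_inf; first by exists (q (x - m0)), m0.
by move=> _ [m Mm <-]; exact: H.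
Qed.

Lemma quotient_norm_adherent M x e : M !=set0 -> 0 < e ->
  exists2 m, M m & q (x - m) < quotient_norm M x + e.
Proof.
move=> [m0 Mm0] e0.
have [|_ [m Mm <-] Hm] := @inf_adherent _ [set q (x - m) | m in M] e e0.
  split; first by exists (q (x - m0)), m0.
  by exists 0 => _ [n _ <-]; exact: (seminorm_ge0 Hq).
by exists m.
Qed.

Lemma quotient_norm_seminorm M : far_ideal M -> is_seminorm io (quotient_norm M).
Proof.
move=> IM; have M0 : M !=set0 by exists 0; exact: ideal0.
have qge0 x : 0 <= quotient_norm M x.
  by apply: le_quotient_norm => // m _; exact: (seminorm_ge0 Hq).
split=> //.
- move=> x y; apply/ler_addgt0Pr => e e0.
  have [|m Mm Hm] := quotient_norm_adherent x M0 (e := e / 2); first by rewrite divr_gt0.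
  have [|n Mn Hn] := quotient_norm_adherent y M0 (e := e / 2); first by rewrite divr_gt0.
  apply: le_trans (quotient_norm_le (x + y) (idealD IM Mm Mn)) _.
  have -> : x + y - (m + n) = (x - m) + (y - n) by ring.
  by have := seminormD Hq (x - m) (y - n); lra.
- move=> x y; apply/ler_addgt0Pr => e e0.
  set a := quotient_norm M x; set b := quotient_norm M y.
  have a0 : 0 <= a by exact: qge0.
  have b0 : 0 <= b by exact: qge0.
  pose d := Num.min 1 (e / (a + b + 1)).
  have d0 : 0 < d by rewrite lt_min ltr01 divr_gt0//; lra.
  have d1 : d <= 1 by rewrite ge_min lexx.
  have d2 : d * (a + b + 1) <= e by rewrite -ler_pdivlMr ?ge_min ?lexx ?orbT//; lra.
  have [m Mm Hm] := quotient_norm_adherent x M0 d0.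
  have [n Mn Hn] := quotient_norm_adherent y M0 d0.
  have Mmn : M (y * m + (x - m) * n) by apply: (idealD IM); exact: idealM.
  apply: le_trans (quotient_norm_le (x * y) Mmn) _.
  have -> : x * y - (y * m + (x - m) * n) = (x - m) * (y - n) by ring.
  apply: le_trans (seminormM Hq _ _) _.
  have := seminorm_ge0 Hq (x - m); have := seminorm_ge0 Hq (y - n).
  by rewrite -/a in Hm; rewrite -/b in Hn; nra.
- move=> c; apply: le_trans (quotient_norm_le _ (ideal0 IM)) _.
  by rewrite subr0; exact: (seminorm_scalar Hq).
- by apply: le_quotient_norm => // m; exact: (ideal_far IM).
Qed.

(** Modulo a maximal far ideal [M] every [h] is a scalar: otherwise no ideal generated by [M] and
    [h - l] is far, so every [h - l] is invertible up to an error below 1 in the quotient seminorm,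
    against Gelfand-Mazur. *)
Theorem exists_contractive_char (J : set L) : far_ideal J ->
  exists2 psi, contractive_char io q psi & forall x, J x -> psi x = 0.
Proof.
move=> /maximal_far_ideal[M [IM JM maxM]].
have qM := quotient_norm_seminorm IM.
have M0 : M !=set0 by exists 0; exact: ideal0.
have MN x : M x -> M (- x) by move=> Mx; rewrite -mulN1r; exact: idealM.
have proper1 c : c != 0 -> ~ M (io c).
  move=> c0 Mc; have := ideal_far IM (idealM IM (io c^-1) Mc).
  by rewrite -rmorphM mulVf// rmorph1 subrr (seminorm0 Hq) ler10.
have value h : exists l, M (h - io l).
  apply: contrapT => nh; apply: (seminormed_Gelfand_Mazur qM (h := h)) => l.
  apply: contrapT => nu; apply: nh; exists l.
  pose B := [set x | exists m, M m /\ exists u, x = m + u * (h - io l)].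
  have : B `<=` M; last first.
    by move=> BM; apply: BM; exists 0; split; [exact: (ideal0 IM)|exists 1; rewrite add0r mul1r].
  apply: maxM; last first.
    by move=> m Mm; exists m; split=> //; exists 0; rewrite mul0r addr0.
  split.
  - by exists 0; split; [exact: (ideal0 IM)|exists 0; rewrite mul0r addr0].
  - move=> _ _ [m [Mm [u ->]]] [n [Mn [v ->]]]; exists (m + n); split; first exact: (idealD IM).
    by exists (u + v); ring.
  - move=> _ y [m [Mm [u ->]]]; exists (y * m); split; first exact: (idealM IM).
    by exists (y * u); ring.
  - move=> _ [m [Mm [u ->]]]; rewrite leNgt; apply/negP => lt1; apply: nu; exists u.
    apply: le_lt_trans (quotient_norm_le _ Mm) _.
    by have -> : 1 - u * (h - io l) - m = 1 - (m + u * (h - io l)) by ring.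
pose psi h := xget 0 [set l | M (h - io l)].
have psiP h : M (h - io (psi h)).
  by have := xgetPex 0 (value h).
have psiU h l : M (h - io l) -> psi h = l.
  move=> Ml; apply: contrapT => /eqP; rewrite -subr_eq0 => ne.
  apply: (proper1 _ ne); rewrite rmorphB.
  have -> : io (psi h) - io l = (h - io l) + - (h - io (psi h)) by ring.
  by apply: (idealD IM) => //; apply: MN; exact: psiP.
exists psi; last by move=> x /JM Mx; apply: psiU; rewrite rmorph0 subr0.
split.
- move=> x y; apply: psiU; rewrite rmorphD.
  have -> : x + y - (io (psi x) + io (psi y)) = (x - io (psi x)) + (y - io (psi y)) by ring.
  by apply: (idealD IM); exact: psiP.
- move=> x y; apply: psiU; rewrite rmorphM.
  have -> : x * y - io (psi x) * io (psi y) =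
     y * (x - io (psi x)) + io (psi x) * (y - io (psi y)) by ring.
  by apply: (idealD IM); apply: (idealM IM); exact: psiP.
- by move=> c; apply: psiU; rewrite subrr; exact: (ideal0 IM).
- move=> x; have [->|px0] := eqVneq (psi x) 0; first by rewrite normc0 (seminorm_ge0 Hq).
  (* This element of [M] is [1 - x / psi x], and its distance at least 1 from the unit gives
     [q (x / psi x) >= 1]. *)
  have /(ideal_far IM) : M (io (- (psi x)^-1) * (x - io (psi x))) by apply: (idealM IM).
  have -> : 1 - io (- (psi x)^-1) * (x - io (psi x)) = io (psi x)^-1 * x.
    rewrite rmorphN; transitivity (1 + io (psi x)^-1 * x - io (psi x)^-1 * io (psi x)).
      by ring.
    by rewrite -rmorphM mulVf// rmorph1; ring.
  move=> /le_trans/(_ (seminormZ_le Hq _ _)); rewrite normcV mulrC ler_pdivlMr ?mul1r//.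
  by rewrite normc_gt0.
Qed.

End Characters.
Arguments far_ideal {R L} q J.

(** * Splitting along an annulus *)

Section CoefSum.
Context {A : comNzRingType} {B : zmodType}.
Implicit Types (F : nat -> A -> B) (p : {poly A}).

Definition coef_sum F p := \sum_(i < size p) F i p`_i.

Lemma coef_sum_widen F p n : (forall i, F i 0 = 0) -> (size p <= n)%N ->
  coef_sum F p = \sum_(i < n) F i p`_i.
Proof.
move=> F0 pn; rewrite /coef_sum (big_ord_widen n (fun i => F i p`_i) pn) big_mkcond /=.
by apply: eq_bigr => i _; case: ltnP => // /leq_sizeP ->.
Qed.

Lemma coef_sumXD F p c : (forall i, F i 0 = 0) ->
  coef_sum F (p * 'X + c%:P) = F 0%N c + coef_sum (fun i => F i.+1) p.
Proof.
move=> F0; rewrite (coef_sum_widen (n := (size p).+1)) //; last first.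
  rewrite size_MXaddC; by case: ifP.
rewrite big_ord_recl coefD coefMX coefC /= add0r; congr (_ + _).
by apply: eq_bigr => i _; rewrite coefD coefMX coefC /= addr0.
Qed.

Lemma coef_sumMX F p : (forall i, F i 0 = 0) ->
  coef_sum F (p * 'X) = coef_sum (fun i => F i.+1) p.
Proof. by move=> F0; rewrite -[p * 'X]addr0 -polyC0 coef_sumXD// F0 add0r. Qed.

Lemma coef_sumC F c : (forall i, F i 0 = 0) -> coef_sum F c%:P = F 0%N c.
Proof.
move=> F0; rewrite (coef_sum_widen (n := 1)) ?size_polyC ?leq_b1//.
by rewrite big_ord1 coefC.
Qed.

Lemma coef_sumD F p r : (forall i x y, F i (x + y) = F i x + F i y) ->
  coef_sum F (p + r) = coef_sum F p + coef_sum F r.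
Proof.
move=> FD; have F0 i : F i 0 = 0.
  by apply: (addrI (F i 0)); rewrite -FD !addr0.
pose n := maxn (size p) (size r).
rewrite !(coef_sum_widen (n := n)) ?leq_maxl ?leq_maxr//; last exact: size_polyD.
by rewrite -big_split /=; apply: eq_bigr => i _; rewrite coefD FD.
Qed.

Lemma coef_sumCM F c p : (forall i, F i 0 = 0) ->
  coef_sum F (c%:P * p) = coef_sum (fun i a => F i (c * a)) p.
Proof.
move=> F0; rewrite (coef_sum_widen (n := size p)) //.
  by apply: eq_bigr => i _; rewrite coefCM.
by rewrite mul_polyC; exact: size_scale_leq.
Qed.

Lemma eq_coef_sum F G p : (forall i a, F i a = G i a) -> coef_sum F p = coef_sum G p.
Proof. by move=> FG; apply: eq_bigr. Qed.

Lemma coef_sum_linear F G p :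
  coef_sum (fun i a => F i a + G i a) p = coef_sum F p + coef_sum G p.
Proof. by rewrite /coef_sum big_split. Qed.

End CoefSum.

Lemma coef_sum_raddf (A : comNzRingType) (B C : zmodType) (F : nat -> A -> B)
    (g : B -> C) (p : {poly A}) : g 0 = 0 -> (forall x y, g (x + y) = g x + g y) ->
  g (coef_sum F p) = coef_sum (fun i a => g (F i a)) p.
Proof. by move=> g0 gD; rewrite /coef_sum; elim/big_rec2: _ => // i x y _ <-; rewrite gD. Qed.

Lemma coef_sumZ (A B : comNzRingType) (F : nat -> A -> B) (r : B) (p : {poly A}) :
  r * coef_sum F p = coef_sum (fun i a => r * F i a) p.
Proof. by rewrite (coef_sum_raddf _ _ (mulr0 r) (mulrDr r)). Qed.

Lemma normc_coef_sum_le (R : realType) (A : comNzRingType) (F : nat -> A -> R[i])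
    (G : nat -> A -> R) (p : {poly A}) :
  (forall i a, normc (F i a) <= G i a) -> normc (coef_sum F p) <= coef_sum G p.
Proof.
move=> FG; rewrite /coef_sum; elim/big_rec2: _ => [|i x y _ xy]; first by rewrite normc0.
by apply: le_trans (le_normcD _ _) _; exact: lerD.
Qed.

Section PolyNorm.
Context {R : realType} {A : comNzRingType} {io : {rmorphism R[i] -> A}}.
Context {q : A -> R} (Hq : is_seminorm io q).
Variable r : R.
Hypothesis r0 : 0 <= r.

(** A weighted l^1 norm; its contractive characters send ['X] into the disc of radius [r]. *)
Definition poly_norm (p : {poly A}) : R := coef_sum (fun i a => q a * r ^+ i) p.

Let F0 i : q 0 * r ^+ i = 0.
Proof. by rewrite (seminorm0 Hq) mul0r. Qed.

Lemma poly_normXD p c : poly_norm (p * 'X + c%:P) = q c + r * poly_norm p.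
Proof.
rewrite /poly_norm coef_sumXD// expr0 mulr1; congr (_ + _).
rewrite /coef_sum big_distrr /=; apply: eq_bigr => i _; rewrite exprS; ring.
Qed.

Lemma poly_normC c : poly_norm c%:P = q c.
Proof. by rewrite /poly_norm coef_sumC// expr0 mulr1. Qed.

Lemma poly_normMX p : poly_norm (p * 'X) = r * poly_norm p.
Proof. by rewrite -[p * 'X]addr0 -polyC0 poly_normXD (seminorm0 Hq) add0r. Qed.

Lemma poly_normX : poly_norm 'X = r.
Proof. by rewrite -(mul1r 'X) poly_normMX -[1]/(1%:P) poly_normC (seminorm_eq1 Hq) mulr1. Qed.

Lemma poly_norm_ge0 p : 0 <= poly_norm p.
Proof.
by apply: sumr_ge0 => i _; rewrite mulr_ge0 ?exprn_ge0// (seminorm_ge0 Hq).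
Qed.

Lemma poly_normD p s : poly_norm (p + s) <= poly_norm p + poly_norm s.
Proof.
pose n := maxn (size p) (size s).
rewrite /poly_norm !(coef_sum_widen (n := n)) ?leq_maxl ?leq_maxr ?size_polyD//.
rewrite -big_split /=; apply: ler_sum => i _; rewrite -mulrDl coefD.
by rewrite ler_wpM2r ?exprn_ge0// (seminormD Hq).
Qed.

Lemma poly_normCM c p : poly_norm (c%:P * p) <= q c * poly_norm p.
Proof.
rewrite /poly_norm coef_sumCM// /coef_sum big_distrr /=; apply: ler_sum => i _.
by rewrite mulrA ler_wpM2r ?exprn_ge0// (seminormM Hq).
Qed.

Lemma poly_normM p s : poly_norm (p * s) <= poly_norm p * poly_norm s.
Proof.
elim/poly_ind: p => [|p c IH].
  by rewrite mul0r -polyC0 poly_normC (seminorm0 Hq) mul0r.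
rewrite poly_normXD mulrDl mulrAC.
apply: le_trans (poly_normD _ _) _; rewrite poly_normMX.
by have := poly_normCM c s; have := ler_wpM2l r0 IH; lra.
Qed.

Lemma poly_norm_seminorm : is_seminorm (polyC \o io : {rmorphism _ -> _}) poly_norm.
Proof.
split; [exact: poly_norm_ge0|exact: poly_normD|exact: poly_normM| |].
  by move=> c /=; rewrite poly_normC (seminorm_scalar Hq).
by rewrite -[X in poly_norm X]/(1%:P) poly_normC (seminorm1 Hq).
Qed.

End PolyNorm.
Arguments poly_norm {R A} q r p.

Section Cousin.
Context {R : realType} {A : comNzRingType} {io : {rmorphism R[i] -> A}}.
Context {q : A -> R} (Hq : is_seminorm io q).
Local Notation chr := (contractive_char io q).

(* A Laurent polynomial is encoded in two variables, the inner ['X%:P] standing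
   for [z] and the outer ['X] for [1/z]; [c j i] is the weight of [z^(i - j)]. *)
Definition laurent_sum (B : comNzRingType) (psi : A -> B) (c : nat -> nat -> B)
  (P : {poly {poly A}}) : B :=
  coef_sum (fun j p => coef_sum (fun i a => psi a * c j i) p) P.

Section LaurentSum.
Variables (B : comNzRingType) (psi : A -> B).
Hypothesis psiD : forall x y, psi (x + y) = psi x + psi y.
Hypothesis psiM : forall x y, psi (x * y) = psi x * psi y.

Let psi0 : psi 0 = 0.
Proof. by apply: (addrI (psi 0)); rewrite -psiD !addr0. Qed.

Let in0 (c : nat -> B) : forall i : nat, psi 0 * c i = 0.
Proof. by move=> i; rewrite psi0 mul0r. Qed.

Let out0 (c : nat -> nat -> B) : forall j : nat, coef_sum (fun i a => psi a * c j i) 0 = 0.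
Proof. by move=> j; rewrite -polyC0 coef_sumC. Qed.

Lemma laurent_sumD c P Q :
  laurent_sum psi c (P + Q) = laurent_sum psi c P + laurent_sum psi c Q.
Proof.
apply: coef_sumD => j x y; apply: coef_sumD => i a b.
by rewrite psiD mulrDl.
Qed.

Lemma laurent_sumMeta c P :
  laurent_sum psi c (P * 'X) = laurent_sum psi (fun j => c j.+1) P.
Proof. by rewrite /laurent_sum coef_sumMX//; exact: out0. Qed.

Lemma laurent_sumMzeta c P :
  laurent_sum psi c (P * 'X%:P) = laurent_sum psi (fun j i => c j i.+1) P.
Proof.
rewrite [X in laurent_sum _ _ X]mulrC /laurent_sum coef_sumCM; last exact: out0.
by apply: eq_coef_sum => j p; rewrite mulrC coef_sumMX.
Qed.

Lemma laurent_sumCM c a P :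
  laurent_sum psi c (P * a%:P%:P) = psi a * laurent_sum psi c P.
Proof.
rewrite [X in laurent_sum _ _ X]mulrC /laurent_sum coef_sumCM; last exact: out0.
rewrite coef_sumZ; apply: eq_coef_sum => j p.
rewrite coef_sumCM// coef_sumZ; apply: eq_coef_sum => i x.
by rewrite psiM mulrA.
Qed.

Lemma laurent_sumN c P : laurent_sum psi c (- P) = - laurent_sum psi c P.
Proof.
apply: (addrI (laurent_sum psi c P)); rewrite -laurent_sumD !subrr.
by rewrite /laurent_sum -polyC0 coef_sumC ?out0//; exact: out0.
Qed.

(** Powers of [psi a] cut off to one half of the exponents satisfy this recurrence with [d]
    concentrated at the exponent -1. Evaluating one half of a Laurent polynomial at [a] thus reduces
    a multiple of [z - a] to a single coefficient. *)
Lemma laurent_sum_zeta_sub c d a P :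
  (forall j i, c j i.+1 = d j i + psi a * c j i) ->
  laurent_sum psi c (P * ('X%:P - a%:P%:P)) = laurent_sum psi d P.
Proof.
move=> cd; rewrite mulrBr laurent_sumD laurent_sumN laurent_sumMzeta laurent_sumCM.
have -> : laurent_sum psi (fun j i => c j i.+1) P =
  laurent_sum psi d P + psi a * laurent_sum psi c P.
  rewrite /laurent_sum coef_sumZ -coef_sum_linear.
  apply: eq_coef_sum => j p; rewrite coef_sumZ -coef_sum_linear.
  by apply: eq_coef_sum => i x; rewrite cd; ring.
by rewrite addrK.
Qed.

(** The weights depend only on [i - j], so the functional descends to Laurent polynomials, where the
    product of [z] and [1/z] is 1. *)
Lemma laurent_sum_zeta_eta c P : (forall j i, c j.+1 i.+1 = c j i) ->
  laurent_sum psi c (P * ('X%:P * 'X - 1)) = 0.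
Proof.
move=> cc; rewrite mulrBr mulr1 mulrA laurent_sumD laurent_sumN laurent_sumMeta laurent_sumMzeta.
suff -> : laurent_sum psi (fun j i => c j.+1 i.+1) P = laurent_sum psi c P by rewrite subrr.
by apply: eq_coef_sum => j p; apply: eq_coef_sum => i x; rewrite cc.
Qed.

Lemma laurent_sum1 c : laurent_sum psi c 1 = psi 1 * c 0%N 0%N.
Proof.
rewrite -[X in laurent_sum _ _ X]/(1%:P%:P) /laurent_sum coef_sumC; last exact: out0.
by rewrite coef_sumC.
Qed.

End LaurentSum.

(** Weight 2 on [z] and weight 1 on [1/z] encode the annulus [1 <= |z| <= 2]. *)
Definition laurent_norm := poly_norm (poly_norm q 2) 1.

Let Hq1 := poly_norm_seminorm Hq (ler0n R 2).
Let Hq2 := poly_norm_seminorm Hq1 (ler0n R 1).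

Lemma normc_laurent_sum_le psi c P : chr psi ->
  (forall j i, normc (c j i) <= 2 ^+ i) -> normc (laurent_sum psi c P) <= laurent_norm P.
Proof.
move=> Hpsi Hc; apply: normc_coef_sum_le => j p; rewrite expr1n mulr1.
apply: normc_coef_sum_le => i a; rewrite normcM.
by apply: ler_pM; rewrite ?normc_ge0// (char_le Hpsi).
Qed.

Variables k f : A.
Hypothesis no_common_zero : forall psi, chr psi -> psi k = 0 ->
  1 <= normc (psi f) <= 2 -> False.

(** Otherwise the ideal of these combinations is far from 1, and some contractive character kills
    it. Its restriction to [A] kills [k], and it sends [z] to the value of [f], which the weights
    force into the annulus. *)
Lemma laurent_Bezout : exists U V W : {poly {poly A}},
  laurent_norm (1 - (U * k%:P%:P + V * ('X%:P - f%:P%:P) + W * ('X%:P * 'X - 1))) < 1.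
Proof.
apply: contrapT => nB.
pose J := [set x : {poly {poly A}} | exists U V W : {poly {poly A}},
  x = U * k%:P%:P + V * ('X%:P - f%:P%:P) + W * ('X%:P * 'X - 1)].
have HJ : far_ideal laurent_norm J.
  split.
  - by exists 0, 0, 0; rewrite !mul0r !addr0.
  - move=> _ _ [U [V [W ->]]] [U' [V' [W' ->]]].
    by exists (U + U'), (V + V'), (W + W'); ring.
  - move=> _ y [U [V [W ->]]].
    by exists (y * U), (y * V), (y * W); ring.
  - move=> _ [U [V [W ->]]]; rewrite leNgt; apply/negP => lt1.
    by apply: nB; exists U, V, W.
have [Psi HPsi PsiJ] := exists_contractive_char Hq2 HJ.
have PsiB x y : Psi (x - y) = Psi x - Psi y.
  apply: (addIr (Psi y)); rewrite -(charD HPsi) !subrK//.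
pose psi a := Psi a%:P%:P.
have Hpsi : chr psi.
  split.
  - by move=> x y; rewrite /psi !polyCD (charD HPsi).
  - by move=> x y; rewrite /psi !polyCM (charM HPsi).
  - exact: (char_scalar HPsi).
  - move=> x; apply: le_trans (char_le HPsi _) _.
    by rewrite (poly_normC Hq1) (poly_normC Hq).
apply: (no_common_zero Hpsi).
  by apply: PsiJ; exists 1, 0, 0; rewrite !mul0r !addr0 mul1r.
have Psi1 : Psi 1 = 1.
  by rewrite -(char_scalar HPsi 1) rmorph1.
have zf : Psi 'X%:P = psi f.
  apply/eqP; rewrite -subr_eq0 -PsiB; apply/eqP/PsiJ.
  by exists 0, 1, 0; rewrite !mul0r mul1r add0r addr0.
have ze : Psi 'X%:P * Psi 'X = 1.
  rewrite -(charM HPsi) -[RHS]Psi1; apply/eqP; rewrite -subr_eq0 -PsiB; apply/eqP/PsiJ.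
  by exists 0, 0, 1; rewrite !mul0r mul1r !add0r.
have z2 : normc (Psi 'X%:P) <= 2.
  by apply: le_trans (char_le HPsi _) _; rewrite (poly_normC Hq1) (poly_normX Hq).
have e1 : normc (Psi 'X) <= 1.
  by apply: le_trans (char_le HPsi _) _; rewrite (poly_normX Hq1).
rewrite -zf z2 andbT; have := congr1 (@normc R) ze; rewrite normcM normc1.
by have := normc_ge0 (Psi 'X%:P); nra.
Qed.

Theorem additive_Cousin : exists M t : R, [/\ 0 < M, 0 < t &
  forall G, q (G - k) <= t -> forall e, 0 < e -> exists v, forall psi, chr psi ->
    (normc (psi f) <= 2 -> exists2 u, normc u <= M &
       normc (psi v - (1 - u * psi G)) <= e) /\
    (1 <= normc (psi f) -> exists2 u, normc u <= M & normc (psi v - u * psi G) <= e)].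
Proof.
have [U [V [W HB]]] := laurent_Bezout; move: HB; set D := 1 - _ => HB.
pose th := laurent_norm D.
have U0 := seminorm_ge0 Hq2 U; rewrite -/laurent_norm in U0.
have th0 : 0 <= th := seminorm_ge0 Hq2 D.
(* Half of the gap [1 - th] is spent on replacing [k] by [G]; the other half keeps the Neumann
   series of [E] bounded independently of [G]. *)
pose th' := (1 + th) / 2.
exists (laurent_norm U / (1 - th') + 1), ((1 - th) / 2 / (laurent_norm U + 1)).
have th'1 : 0 < 1 - th' by rewrite /th'; rewrite /th; lra.
split.
- by rewrite ltr_wpDl// divr_ge0// ltW.
- by rewrite divr_gt0 ?divr_gt0//; rewrite -/th in HB; lra.
move=> G HG e e0.
pose E := 1 - (U * G%:P%:P + V * ('X%:P - f%:P%:P) + W * ('X%:P * 'X - 1)).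
have HE : laurent_norm E <= th'.
  have -> : E = D - U * (G - k)%:P%:P by rewrite !polyCB /E /D; ring.
  apply: le_trans (seminormB Hq2 _ _) _; rewrite -/laurent_norm -/th.
  have := seminormM Hq2 U (G - k)%:P%:P; rewrite (poly_normC Hq1) (poly_normC Hq).
  rewrite -/laurent_norm => H1; rewrite ler_pdivlMr in HG; last by lra.
  have := seminorm_ge0 Hq (G - k); rewrite /th'; nra.
have [n Hn] : exists n, laurent_norm E ^+ n <= e.
  apply: exists_expr_le => //; apply/andP; split; first exact: (seminorm_ge0 Hq2).
  by apply: le_lt_trans HE _; lra.
have En : laurent_norm (E ^+ n) <= e := le_trans (seminormX Hq2 _ _) Hn.
pose Y := \sum_(j < n) E ^+ j.
have rel : U * Y * G%:P%:P + V * Y * ('X%:P - f%:P%:P) + W * Y * ('X%:P * 'X - 1) + E ^+ n = 1.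
  have -> : E ^+ n = 1 - (1 - E) * Y by rewrite mul_geometric; ring.
  by rewrite /E; ring.
have UY : laurent_norm (U * Y) <= laurent_norm U / (1 - th') + 1.
  apply: le_trans (seminormM Hq2 _ _) _; rewrite -/laurent_norm.
  have H1 : laurent_norm Y <= (1 - laurent_norm E)^-1.
    by apply: (seminorm_geometric Hq2); apply: le_lt_trans HE _; lra.
  have H2 : (1 - laurent_norm E)^-1 <= (1 - th')^-1.
    rewrite lef_pV2 ?posrE ?lerD2l ?lerN2//.
    by rewrite subr_gt0; apply: le_lt_trans HE _; rewrite -subr_gt0.
  apply: (@le_trans _ _ (laurent_norm U / (1 - th'))); last by rewrite lerDl ler01.
  by rewrite ler_wpM2l//; exact: le_trans H2.
(* These weights extract the coefficient of [z^-1]. *)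
pose dlt (B : comNzRingType) (j i : nat) : B := (j == i.+1)%:R.
exists (laurent_sum id (dlt A) (V * Y)) => psi Hpsi.
have psi0 : psi 0 = 0.
  by apply: (addrI (psi 0)); rewrite -(charD Hpsi) !addr0.
have psi1 : psi 1 = 1 by rewrite -(rmorph1 io) (char_scalar Hpsi).
have Ev : psi (laurent_sum id (dlt A) (V * Y)) = laurent_sum psi (dlt _) (V * Y).
  rewrite /laurent_sum (coef_sum_raddf _ _ psi0 (charD Hpsi)).
  apply: eq_coef_sum => j p; rewrite (coef_sum_raddf _ _ psi0 (charD Hpsi)).
  apply: eq_coef_sum => i a; rewrite (charM Hpsi) /dlt.
  by case: (j == i.+1); rewrite ?psi1 ?psi0.
have apply_rel c s : (forall j i, c j.+1 i.+1 = c j i) ->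
    (forall j i, c j i.+1 = s * dlt _ j i + psi f * c j i) ->
    laurent_sum psi c (U * Y) * psi G + s * laurent_sum psi (dlt _) (V * Y)
    + laurent_sum psi c (E ^+ n) = c 0%N 0%N.
  move=> c1 c2; have := congr1 (laurent_sum psi c) rel.
  rewrite !(laurent_sumD (charD Hpsi)) (laurent_sumCM (charD Hpsi) (charM Hpsi)).
  rewrite (laurent_sum_zeta_eta (charD Hpsi) (W * Y) c1) addr0.
  rewrite (laurent_sum_zeta_sub (charD Hpsi) (charM Hpsi) _ c2).
  rewrite (laurent_sum1 (charD Hpsi)) psi1 mul1r => <-; congr (_ + _ + _).
    exact: mulrC.
  rewrite /laurent_sum coef_sumZ; apply: eq_coef_sum => j p.
  by rewrite coef_sumZ; apply: eq_coef_sum => i a; ring.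
split=> [f2|f1].
  (* Evaluation at [f] of the powers with exponent at least 0. It turns the term in [z - f] into the
     coefficient of [z^-1]. *)
  pose c j i : R[i] := if (j <= i)%N then psi f ^+ (i - j) else 0.
  have c1 j i : c j.+1 i.+1 = c j i by rewrite /c ltnS subSS.
  have c2 j i : c j i.+1 = 1 * dlt _ j i + psi f * c j i.
    rewrite /c /dlt mul1r; case: (ltngtP j i.+1) => [ji|ji|->].
    + by rewrite (ji : (j <= i)%N) subSn// exprS add0r.
    + by rewrite (leqNgt j i) (ltn_trans (ltnSn i) ji) /= mulr0 addr0.
    + by rewrite subnn expr0 ltnn mulr0 addr0.
  have H := apply_rel c 1 c1 c2.
  have cb j i : normc (c j i) <= 2 ^+ i.
    rewrite /c; case: ifP => ji; last by rewrite normc0 exprn_ge0.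
    rewrite normcX; apply: (@le_trans _ _ (2 ^+ (i - j))).
      by rewrite lerXn2r ?nnegrE ?normc_ge0.
    by rewrite ler_weXn2l ?leq_subr// ler1n.
  exists (laurent_sum psi c (U * Y)).
    by apply: le_trans UY; exact: normc_laurent_sum_le.
  apply: le_trans En; apply: le_trans (normc_laurent_sum_le (E ^+ n) Hpsi cb).
  rewrite Ev -normcN (_ : - (_ - _) = laurent_sum psi c (E ^+ n)) //.
  by have <- : c 0%N 0%N = 1; [rewrite /c leqnn subnn|rewrite -H; ring].
(* Evaluation at [f] of the negative powers. The same coefficient of [z^-1] now appears with the
   opposite sign, and the unit contributes 0. *)
pose c j i : R[i] := if (i < j)%N then (psi f)^-1 ^+ (j - i) else 0.
have f0 : psi f != 0.
  by apply: contraTneq f1 => ->; rewrite normc0 ler10.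
have c1 j i : c j.+1 i.+1 = c j i by rewrite /c ltnS subSS.
have c2 j i : c j i.+1 = -1 * dlt _ j i + psi f * c j i.
  rewrite /c /dlt mulN1r; case: (ltngtP j i.+1) => [ji|ji|->].
  + by rewrite oppr0 mulr0 addr0.
  + rewrite oppr0 add0r.
    by rewrite -(subnSK (ltn_trans (ltnSn i) ji)) exprS mulrA divff// mul1r.
  + by rewrite subSn// subnn expr1 divff// addNr.
have H := apply_rel c (-1) c1 c2.
have cb j i : normc (c j i) <= 2 ^+ i.
  rewrite /c; case: ifP => ji; last by rewrite normc0 exprn_ge0.
  rewrite normcX normcV; apply: (@le_trans _ _ 1); last by rewrite exprn_ege1// ler1n.
  by rewrite exprn_ile1// ?invr_ge0 ?normc_ge0// invf_le1//; apply: lt_le_trans f1.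
exists (laurent_sum psi c (U * Y)).
  by apply: le_trans UY; exact: normc_laurent_sum_le.
apply: le_trans En; apply: le_trans (normc_laurent_sum_le (E ^+ n) Hpsi cb).
rewrite Ev (_ : _ - _ = laurent_sum psi c (E ^+ n)) //.
have c0 : c 0%N 0%N = 0 by rewrite /c ltnn.
by apply: subr0_eq; rewrite -oppr0 -c0 -H; ring.
Qed.

End Cousin.

(** * Minimal boundaries *)

Section Covers.
Context {T : topologicalType}.

Lemma compact_finite_cover (I : eqType) (S : set T) (D : I -> Prop) (U : I -> set T) :
  compact S -> (forall x, S x -> exists2 i, D i & nbhs x (U i)) ->
  exists2 s : seq I, (forall i, i \in s -> D i) &
    forall x, S x -> exists2 i, i \in s & U i x.
Proof.
move=> /compact_near_coveringP cS HU.
(* The filter of properties that hold for all sufficiently large finite lists; the near-covering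
   form of compactness for it yields a finite subcover. *)
pose F : set_system (seq I) := [set A : set (seq I) | exists2 s0 : seq I,
  (forall i, i \in s0 -> D i) & forall s, {subset s0 <= s} -> A s].
have FF : Filter F.
  split.
  - by exists [::].
  - move=> A B [s sD sA] [t tD tB]; exists (s ++ t).
      by move=> i; rewrite mem_cat => /orP[/sD|/tD].
    move=> u us; split; [apply: sA|apply: tB] => i si; apply: us;
      by rewrite mem_cat si ?orbT.
  - by move=> A B AB [s sD sA]; exists s => // u us; apply: AB; exact: sA.
have [s sD Hs] : F [set s : seq I | S `<=` [set x | exists2 i, i \in s & U i x]].
  apply: (cS _ F (fun s x => exists2 i, i \in s & U i x) FF) => x Sx; have [i Di Ui] := HU x Sx.
  exists (U i, [set s : seq I | i \in s]).
    split=> //=; exists [:: i]; first by move=> j; rewrite inE => /eqP ->.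
    by move=> s si /=; apply: si; rewrite inE.
  by move=> [y s] /= [Uy si]; exists i.
by exists s => //; exact: Hs.
Qed.

Lemma closed_compact (S : set T) : compact [set: T] -> closed S -> compact S.
Proof. by move=> cT clS; apply: subclosed_compact clS cT _ => ?. Qed.

Lemma compact_chain_cover (S : set T) (F : set (set T)) :
  compact S -> S !=set0 -> (forall O, F O -> open O) -> total_on F subset ->
  S `<=` \bigcup_(O in F) O -> exists2 O, F O & S `<=` O.
Proof.
move=> cS [x0 Sx0] Fo Ftot SF.
have [|s sF Hs] := @compact_finite_cover (set T) S F id cS.
  move=> x /SF[O FO Ox]; exists O => //; apply: open_nbhs_nbhs; split=> //; exact: Fo.
have {}Sx0 : s != [::] by have [i + _] := Hs _ Sx0; case: (s).
have [O FO HO] : exists2 O, F O & forall i, i \in s -> i `<=` O.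
  elim: s sF Sx0 {Hs} => // O [|O' s] IH sF _.
    by exists O; [apply: sF; rewrite inE|move=> i; rewrite inE => /eqP ->].
  have [|//|P FP HP] := IH.
    by move=> i si; apply: sF; rewrite inE si orbT.
  have FO : F O by apply: sF; rewrite inE eqxx.
  have [OP|PO] := Ftot _ _ FO FP.
    by exists P => // i; rewrite inE => /orP[/eqP ->//|/HP].
  by exists O => // i; rewrite inE => /orP[/eqP ->//|/HP] /subset_trans; apply.
by exists O => // x /Hs[i /HO]; apply.
Qed.

Lemma compact_max (R : realType) (g : T -> R) (S : set T) :
  compact S -> S !=set0 -> continuous g ->
  exists2 x, S x & forall t, S t -> g t <= g x.
Proof.
move=> cS S0 cg; have [|x xS H] := compact_EVT_max S0 cS (f := g).
  exact: continuous_subspaceT.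
by exists x; [exact: set_mem|move=> t St; apply: H; exact: mem_set].
Qed.

End Covers.

Section Boundary.
Context {R : realType} {T : topologicalType} {L : comPzRingType}.
Variable v : T -> L -> R[i].
Hypothesis vM : forall t a b, v t (a * b) = v t a * v t b.
Hypothesis v1 : forall t, v t 1 = 1.
Hypothesis v_cont : forall a, continuous (fun t => normc (v t a)).

(** The evaluation [v] is abstract because boundaries are needed both for points of [X] and for
    characters. *)
Definition boundary_of (Q B : set T) := [/\ closed B, B `<=` Q &
  forall a x, Q x -> exists2 b, B b & normc (v x a) <= normc (v b a)].

Definition minimal_boundary Q K := boundary_of Q K /\
  forall B, boundary_of Q B -> B `<=` K -> K `<=` B.

Lemma closed_normc_ge a c : closed [set t | c <= normc (v t a)].
Proof. by have /continuous_closedP/(_ _ (@closed_ge _ c)) := @v_cont a. Qed.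

Lemma open_normc_lt a c : open [set t | normc (v t a) < c].
Proof. by have /continuousP/(_ _ (@open_lt _ c)) := @v_cont a. Qed.

Lemma open_normc_gt a c : open [set t | c < normc (v t a)].
Proof. by have /continuousP/(_ _ (@open_gt _ c)) := @v_cont a. Qed.

Lemma open_polydisc (fs : seq L) c : open [set t | forall f, f \in fs -> normc (v t f) < c].
Proof.
elim: fs => [|f fs IH].
  by rewrite (_ : mkset _ = setT); [exact: openT|apply/seteqP; split].
rewrite (_ : mkset _ = [set t | normc (v t f) < c] `&`
   [set t | forall f, f \in fs -> normc (v t f) < c]).
  by apply: openI => //; exact: open_normc_lt.
apply/seteqP; split=> t /=.
  by move=> H; split=> [|g gs]; apply: H; rewrite inE ?eqxx// gs orbT.
by move=> [Hf H] g; rewrite inE => /orP[/eqP ->|/H].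
Qed.

Lemma evalX t a n : v t (a ^+ n) = v t a ^+ n.
Proof. by elim: n => [|n IH]; rewrite ?expr0 ?v1// !exprS vM IH. Qed.

(** Zorn's lemma on the open sets whose removal leaves a boundary. The maximum points of [|a|] over
    [Q] form a compact set; if the union of a chain covered it, a single member would, and its
    removal would not leave a boundary. *)
Lemma exists_minimal_boundary (Q : set T) : compact Q -> closed Q ->
  exists K, minimal_boundary Q K.
Proof.
move=> cQ clQ; pose P O := open O /\ boundary_of Q (Q `\` O).
have [|O [[oO bO] maxO]] := @Zorn_bigcup T P.
  move=> F FP Ftot; have oF : open (\bigcup_(X in F) X).
    by apply: bigcup_open => O /FP[].
  split=> //; split; first by rewrite setDE; apply: closedI => //; exact: open_closedC.
    by move=> x [].
  move=> a x Qx.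
  have [c Qc Hc] := compact_max cQ (ex_intro _ x Qx) (@v_cont a).
  apply: contrapT => nb.
  pose S := Q `&` [set t | normc (v c a) <= normc (v t a)].
  have [| | | | |O FO SO] := @compact_chain_cover T S F.
  - by apply: compact_closedI => //; exact: closed_normc_ge.
  - by exists c; split => /=.
  - by move=> O /FP[].
  - exact: Ftot.
  - move=> t [Qt /= tc]; apply: contrapT => nt; apply: nb; exists t => //.
    by apply: le_trans tc; exact: Hc.
  - have [_ [_ _ /(_ a c Qc)[b [Qb nOb] cb]]] := FP _ FO.
    by apply: nOb; apply: SO; split.
exists (Q `\` O); split=> // B [clB BQ bB] BO t [Qt nOt].
apply: contrapT => nBt; apply: (maxO (~` B)); last first.
  split; first exact: closed_openC.
  by rewrite setDE setCK setIidr//; split.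
split=> [s Os Bs|H]; first by have [] := BO _ Bs.
by apply: nOt; apply: H.
Qed.

(** By minimality, [K] without the neighbourhood [N] of [y] is no boundary, so some [a] has a
    maximum [c] over [Q] that exceeds its maximum over [K \ N]. For large [m], [|a^m f| < c^m] on
    [K]: inside [N] because [|f| < 1], outside because [|a|/c] is bounded below 1. The inequality
    extends to [Q], hence [|f| < 1] wherever [|a| = c]. *)
Lemma minimal_boundary_peak (Q K : set T) y (fs : seq L) :
  compact Q -> minimal_boundary Q K -> K y ->
  (forall f, f \in fs -> normc (v y f) < 1) ->
  exists a x1, [/\ Q x1, forall t, Q t -> normc (v t a) <= normc (v x1 a) &
    forall t, Q t -> normc (v x1 a) <= normc (v t a) ->
      forall f, f \in fs -> normc (v t f) < 1].
Proof.
move=> cQ [[clK KQ bK] minK] Ky Hfs.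
pose N := [set t | forall f, f \in fs -> normc (v t f) < 1].
have oN : open N by exact: open_polydisc.
pose B := K `\` N.
have clB : closed B by rewrite /B setDE; apply: closedI => //; exact: open_closedC.
have cB : compact B by apply: subclosed_compact clB cQ _ => t [/KQ].
have [a [x1 [Qx1 max1 pos1 lt1]]] : exists a x1,
    [/\ Q x1, forall t, Q t -> normc (v t a) <= normc (v x1 a), 0 < normc (v x1 a) &
        forall b, B b -> normc (v b a) < normc (v x1 a)].
  have [[b Bb]|B0] := pselect (B !=set0); last first.
    exists 1, y; split; rewrite ?v1 ?normc1//; first exact: KQ.
      by move=> t _; rewrite v1 normc1.
    by move=> b Bb; exfalso; apply: B0; exists b.
  have [a [x Qx Hx]] : exists a, exists2 x, Q x & forall b, B b -> normc (v b a) < normc (v x a).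
    apply: contrapT => H; have /minK/(_ (@subIsetl _ _ _))/(_ y Ky)[_] : boundary_of Q B.
      split=> // [t [/KQ]//|a x Qx]; apply: contrapT => nb; apply: H; exists a, x => // d Bd.
      by rewrite ltNge; apply/negP => xd; apply: nb; exists d.
    by apply.
  have [x1 Qx1 H1] := compact_max cQ (ex_intro _ x Qx) (@v_cont a).
  have lt1 c : B c -> normc (v c a) < normc (v x1 a).
    by move=> Bc; apply: lt_le_trans (H1 x Qx); exact: Hx.
  by exists a, x1; split=> //; apply: le_lt_trans (lt1 b Bb); exact: normc_ge0.
exists a, x1; split=> // t Qt x1t f ffs.
set c := normc (v x1 a) in pos1 x1t max1 lt1.
have [xC QxC HC] := compact_max cQ (ex_intro _ t Qt) (@v_cont f).
set C := normc (v xC f) in HC; have C0 : 0 <= C := normc_ge0 _.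
have [th [th0 th1 Hth]] : exists th,
    [/\ 0 <= th, th < 1 & forall b, B b -> normc (v b a) <= th * c].
  have [[b Bb]|B0] := pselect (B !=set0); last first.
    by exists 0; split=> // b Bb; exfalso; apply: B0; exists b.
  have [b1 Bb1 H1] := compact_max cB (ex_intro _ b Bb) (@v_cont a).
  exists (normc (v b1 a) / c); split.
  - by rewrite divr_ge0 ?normc_ge0// ltW.
  - by rewrite ltr_pdivrMr// mul1r; exact: lt1.
  - by move=> b' Bb'; rewrite divfK ?gt_eqF//; exact: H1.
(* This [m] gives [th^m * C < 1], where [C] bounds [|f|] over [Q]. *)
have [||m Hm] := @exists_expr_le R th (C + 1)^-1.
- by rewrite th0 th1.
- by rewrite invr_gt0; lra.
have [b Kb] := bK (a ^+ m * f) t Qt.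
rewrite !vM !evalX !normcM !normcX => Hb.
have cm : 0 < c ^+ m by rewrite exprn_gt0.
have tm : c ^+ m <= normc (v t a) ^+ m by rewrite lerXn2r ?nnegrE ?normc_ge0// ltW.
have {tm}Hb : c ^+ m * normc (v t f) <= normc (v b a) ^+ m * normc (v b f).
  by apply: le_trans Hb; rewrite ler_wpM2r ?normc_ge0.
suff : normc (v b a) ^+ m * normc (v b f) < c ^+ m.
  by move=> /(le_lt_trans Hb); rewrite gtr_pMr.
have [Nb|nNb] := pselect (N b).
  have bm : normc (v b a) ^+ m <= c ^+ m.
    by rewrite lerXn2r ?nnegrE ?normc_ge0//; apply: max1; exact: KQ.
  apply: (@le_lt_trans _ _ (c ^+ m * normc (v b f))); first by rewrite ler_wpM2r ?normc_ge0.
  by rewrite gtr_pMr//; exact: Nb.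
have bm : normc (v b a) ^+ m <= th ^+ m * c ^+ m.
  by rewrite -exprMn lerXn2r ?nnegrE ?normc_ge0 ?mulr_ge0 ?(ltW pos1)//; exact: Hth.
have bC : normc (v b f) <= C by apply: HC; exact: KQ.
apply: (@le_lt_trans _ _ (th ^+ m * c ^+ m * C)).
  by apply: ler_pM; rewrite ?exprn_ge0 ?normc_ge0.
apply: (@le_lt_trans _ _ ((C + 1)^-1 * c ^+ m * C)).
  by rewrite ler_wpM2r// ler_wpM2r// ltW.
by rewrite mulrC mulrA gtr_pMl// ltr_pdivrMr; lra.
Qed.

(** If [B] misses a point [y] of [K], finitely many functions vanishing at [y] have, at each point
    of [B], a member of modulus at least 1. A peaking [a] for them attains its maximum over [Q]
    nowhere on [B]. *)
Lemma minimal_boundary_least (Q K B : set T) :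
  (forall x y, x <> y -> exists2 f, v y f = 0 & 2 < normc (v x f)) ->
  compact Q -> minimal_boundary Q K -> boundary_of Q B -> K `<=` B.
Proof.
move=> sep cQ mK [clB BQ bB] y Ky; apply: contrapT => nBy.
have cB : compact B by exact: subclosed_compact clB cQ BQ.
have [|fs fs0 Hfs] := @compact_finite_cover T L B (fun f => v y f = 0)
  (fun f => [set t | 1 <= normc (v t f)]) cB.
  move=> x Bx; have [|f fy fx] := sep x y; first by move=> xy; apply: nBy; rewrite -xy.
  exists f => //; apply: filterS (open_nbhs_nbhs (conj (open_normc_gt f 1) _)) => /=.
    by move=> t /ltW.
  by lra.
have [|a [x1 [Qx1 max1 H1]]] := minimal_boundary_peak (fs := fs) cQ mK Ky.
  by move=> f /fs0 ->; rewrite normc0.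
have [b Bb x1b] := bB a x1 Qx1; have [f ffs] := Hfs b Bb.
by move=> /= ; rewrite leNgt => /negP; apply; apply: (H1 b) => //; exact: BQ.
Qed.

End Boundary.

(** * Uniform algebras *)

Section NormcTopology.
Context {R : realType}.

Lemma normcB_le (x y : R[i]) : `|normc x - normc y| <= normc (x - y).
Proof.
have H (a b : R[i]) : normc a - normc b <= normc (a - b).
  by have := le_normcD (a - b) b; rewrite subrK; lra.
have H1 := H x y; have H2 := H y x; have H3 := normcN (x - y); rewrite opprB in H3.
by rewrite ler_norml; apply/andP; split; lra.
Qed.

Lemma normc_continuous : continuous (@normc R : R[i]^o -> R).
Proof.
move=> z U /nbhs_ballP[e /= e0 eU]; apply/nbhs_ballP.
exists e%:C%C => /=; first by rewrite ltcR.
move=> y; rewrite -ball_normE /ball_ /= normr_normc ltcR => zy.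
apply: eU; rewrite -ball_normE /ball_ /=.
by apply: le_lt_trans zy; exact: normcB_le.
Qed.

End NormcTopology.

Section UniformAlgebraTheory.
Context {R : realType} {X : topologicalType}.
Variable A : uniformAlgebra R X.
Local Notation Phi := (character A).

Lemma char_continuous (f : elt A) : continuous (fun phi : Phi => phi f).
Proof.
move=> phi; apply: (@continuous_comp Phi {ptws elt A -> R[i]^o} R[i]^o
  (fun phi : Phi => (phi : elt A -> R[i]^o)) (fun g => g f)).
  exact: initial_continuous.
exact: (@proj_continuous (elt A) (fun _ => R[i]^o) f).
Qed.

Lemma ev_continuous : continuous (@ev R X A).
Proof.
apply: continuous_comp_initial => x; apply/cvg_sup => f.
apply: (@continuous_comp_initial _ X _ (fun g : elt A -> R[i]^o => g f)
   (fun x : X => (ev A x : elt A -> R[i]^o))) => {}x.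
exact: (ua_continuous (set_mem (elt_mem f))).
Qed.

Lemma near_uniform (s : X -> R[i]^o) (e : R) : 0 < e ->
  \forall g \near (s : {uniform X -> R[i]^o}), forall x, normc (s x - g x) < e.
Proof.
move=> e0; rewrite -nbhs_nearE; apply/uniform_nbhs.
exists [set xy | ball xy.1 e%:C%C xy.2]; split.
  by rewrite -entourage_from_ballE; exists e%:C%C => //=; rewrite ltcR.
move=> g Hg x; have := Hg x I; rewrite /= -ball_normE /ball_ /= normr_normc ltcR //.
Qed.


Section CharTheory.
Variable phi : Phi.

Lemma characterD f g : phi (f + g) = phi f + phi g.
Proof. by have := char_linear phi 1 f g; rewrite !scale1r. Qed.

Lemma characterM f g : phi (f * g) = phi f * phi g.
Proof. by have [_ ->] := char_monoid phi. Qed.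

Lemma character1 : phi 1 = 1.
Proof. by have [] := char_monoid phi. Qed.

Lemma character0 : phi 0 = 0.
Proof. by apply: (addrI (phi 0)); rewrite -characterD !addr0. Qed.

Lemma characterZ c f : phi (c *: f) = c * phi f.
Proof. by have := char_linear phi c f 0; rewrite !addr0 character0 addr0. Qed.

Lemma characterB f g : phi (f - g) = phi f - phi g.
Proof. by apply: (addIr (phi g)); rewrite -characterD !subrK. Qed.

End CharTheory.

Lemma elt_ext (f g : elt A) : (forall x, f x = g x) -> f = g.
Proof. by move=> fg; apply: val_inj; apply/funext. Qed.

Lemma char_ext (phi psi : Phi) : (forall f, phi f = psi f) -> phi = psi.
Proof.
case: phi psi => [p lp mp] [r lr mr] /= pr.
have {}pr : p = r by apply/funext.
by subst r; congr Character; exact: Prop_irrelevance.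
Qed.

Lemma char_sep (phi psi : Phi) : phi <> psi ->
  exists2 f : elt A, psi f = 0 & 2 < normc (phi f).
Proof.
move=> ne; have [f fne] : exists f : elt A, phi f <> psi f.
  apply: contrapT => H; apply: ne; apply: char_ext => f.
  by apply: contrapT => ?; apply: H; exists f.
pose d := phi f - psi f; have d0 : d != 0 by rewrite subr_eq0; apply/eqP.
(* The value 3 at [phi] exceeds 2, the bound that defines polyhedra. *)
exists ((3 / d : R[i]) *: (f - (psi f : R[i]) *: (1 : elt A))).
  by rewrite characterZ characterB characterZ character1 mulr1 subrr mulr0.
rewrite characterZ characterB characterZ character1 mulr1 -/d mulfVK//.
have -> : (3 : R[i]) = (3 : R)%:C%C by rewrite rmorph_nat.
by rewrite normc_real; lra.
Qed.

Lemma normc_char_continuous f : continuous (fun phi : Phi => normc (phi f)).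
Proof.
move=> phi; apply: (@continuous_comp Phi R[i]^o R (fun phi : Phi => phi f)).
  exact: char_continuous.
exact: normc_continuous.
Qed.

Lemma char_hausdorff : hausdorff_space Phi.
Proof.
rewrite open_hausdorff => phi psi /eqP ne; have [f f0 f2] := char_sep ne.
have /continuousP co := @normc_char_continuous f.
exists ([set p : Phi | 1 < normc (p f)], [set p : Phi | normc (p f) < 1]).
  by split; rewrite inE /= ?f0 ?normc0//; lra.
split; [exact: co _ (@open_gt _ 1)|exact: co _ (@open_lt _ 1)|].
by apply/eqP/seteqP; split=> // p /= [H1 H2]; have := lt_trans H1 H2; rewrite ltxx.
Qed.

Lemma uniform_limit_mem (s : X -> R[i]^o) :
  (forall e : R, 0 < e -> exists g : elt A, forall x, normc (s x - g x) < e) -> ua_set A s.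
Proof.
move=> H; apply: ua_closed => U /uniform_nbhs[E [+ EU]].
rewrite -entourage_from_ballE => -[e /= e0 eE].
have [eR er] : exists2 d : R, 0 < d & e = d%:C%C.
  case: e e0 {eE} => a b; rewrite ltcE /= => /andP[/eqP b0 a0]; exists a => //.
  by apply/eqP; rewrite eq_complex /= b0 !eqxx.
move=> ee; have [g Hg] := H eR er; exists (g : X -> _); split.
  exact: set_mem (elt_mem g).
apply: EU => x _; apply: eE; rewrite /= -ball_normE /ball_ /= normr_normc ee ltcR.
exact: Hg.
Qed.

Lemma dense_invertiblesP : dense_invertibles A -> forall (k : elt A) (e : R), 0 < e ->
  exists G H : elt A, G * H = 1 /\ forall x, normc (k x - G x) < e.
Proof.
move=> dA k e e0.
have cval : continuous (fun f : elt A => (val f : {uniform X -> R[i]^o})).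
  exact: initial_continuous.
have nk : nbhs k [set g : elt A | forall x, normc (k x - g x) < e].
  exact: (cval k _ (near_uniform (val k) e0)).
have [G [Gk [H GH]]] := dA _ (ex_intro _ k nk) (@open_interior _ _).
exists G, H; split=> //; exact: (interior_subset Gk).
Qed.

(** Characters are purely algebraic here. If [|phi h| > c], then [g = h / phi h] has norm below 1,
    so the sum [S] of its geometric series lies in [A]; applying [phi] to [S = 1 + g S] gives
    [0 = 1]. *)
Lemma char_contractive (x0 : X) (phi : Phi) (h : elt A) (c : R) :
  (forall x, normc (h x) <= c) -> normc (phi h) <= c.
Proof.
move=> hc; rewrite leNgt; apply/negP => cl.
have c0 : 0 <= c := le_trans (normc_ge0 _) (hc x0).
pose l := phi h; have l0 : l != 0.
  by apply: contraTneq cl => l0; rewrite -leNgt -/l l0 normc0.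
pose g := l^-1 *: h; pose th := c / normc l.
have nl : 0 < normc l by apply: le_lt_trans cl.
have th1 : th < 1 by rewrite ltr_pdivrMr// mul1r.
have th0 : 0 <= th by rewrite divr_ge0// ltW.
have gth x : normc (g x) <= th.
  have -> : g x = l^-1 * h x by [].
  by rewrite normcM normcV mulrC ler_wpM2r// invr_ge0 ltW.
have g1 x : 1 - g x != 0.
  rewrite subr_eq0; apply/eqP => g1; have := gth x; rewrite -g1 normc1.
  by rewrite leNgt th1.
pose s : X -> R[i]^o := fun x => (1 - g x)^-1.
have As : ua_set A s.
  apply: uniform_limit_mem => e e0.
  have [||n Hn] := @exists_expr_le R th (e * (1 - th) / 2).
  - by rewrite th0.
  - by rewrite divr_gt0// mulr_gt0// subr_gt0.
  exists (\sum_(j < n) g ^+ j) => x.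
  have -> : (\sum_(j < n) g ^+ j) x = \sum_(j < n) (g x) ^+ j :> R[i].
    elim/big_rec2: _ => // j y1 y2 _ <-; rewrite -[LHS]/((g ^+ j) x + y2 x).
    suff -> : (g ^+ j) x = g x ^+ j :> R[i] by [].
    by elim: (nat_of_ord j) => // m IH; rewrite !exprS -IH.
  have -> : s x - \sum_(j < n) g x ^+ j = g x ^+ n / (1 - g x).
    apply: (mulIf (g1 x)); rewrite divfK// mulrBl mulVf// mulrC mul_geometric; ring.
  rewrite normcM normcX normcV.
  have d1 : 1 - th <= normc (1 - g x).
    by have := le_normcD (1 - g x) (g x); rewrite subrK normc1; have := gth x; lra.
  have p1 : normc (g x) ^+ n <= e * (1 - th) / 2.
    by apply: le_trans Hn; rewrite lerXn2r ?nnegrE ?normc_ge0.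
  rewrite ltr_pdivrMr; last by lra.
  apply: (@lt_le_trans _ _ (e * (1 - th))); last by rewrite ler_wpM2l// ltW.
  by apply: le_lt_trans p1 _; have : 0 < e * (1 - th) by [rewrite mulr_gt0// subr_gt0]; lra.
pose S : elt A := Elt (mem_set As).
have : S = 1 + g * S.
  have sE x : s x = 1 + g x * s x.
    apply: (mulIf (g1 x)); rewrite /s mulrDl -mulrA mulVf// mulr1 mul1r.
    by rewrite subrK.
  by clearbody s; apply: elt_ext => x; exact: sE.
clearbody S => /(congr1 phi); rewrite characterD character1 characterM characterZ -/l mulVf// mul1r.
by move=> /eqP; rewrite -subr_eq subrr eq_sym oner_eq0.
Qed.

End UniformAlgebraTheory.

(** * The sup seminorm over a compact set of characters *)

Section NonTrivial.
Context {R : realType} {X : topologicalType} (A : uniformAlgebra R X) (x0 : X).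
Local Notation Phi := (character A).

Lemma elt_oner_neq0 : (1 : elt A) != 0.
Proof.
apply/eqP => /(congr1 (fun f : elt A => f x0)); rewrite -[LHS]/(1 : R[i]) -[RHS]/(0 : R[i]).
by move/eqP; rewrite oner_eq0.
Qed.

(* [elt A] only carries a possibly trivial ring structure, as [X] may be empty;
   polynomials over it require [1 != 0]. *)
Definition elt_nzRing : comNzRingType :=
  HB.pack (elt A) (GRing.PzSemiRing_isNonZero.Build (elt A) elt_oner_neq0).

Definition elt_scalar (c : R[i]) : elt_nzRing := c *: (1 : elt A).

Lemma elt_scalar_zmod : zmod_morphism elt_scalar.
Proof. by move=> a b; exact: scalerBl. Qed.

Lemma elt_scalar_monoid : monoid_morphism elt_scalar.
Proof.
split; first exact: (scale1r (1 : elt A)).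
move=> a b; apply: (@elt_ext _ _ A) => x.
rewrite -[LHS]/((a * b) * 1) -[RHS]/((a * 1) * (b * 1)); ring.
Qed.

HB.instance Definition _ := GRing.isZmodMorphism.Build R[i] elt_nzRing elt_scalar elt_scalar_zmod.
HB.instance Definition _ :=
  GRing.isMonoidMorphism.Build R[i] elt_nzRing elt_scalar elt_scalar_monoid.

Variable Q : set Phi.
Hypothesis cQ : compact Q.
Hypothesis Q0 : Q !=set0.

Definition sup_norm (f : elt_nzRing) : R := sup [set normc (phi (f : elt A)) | phi in Q].

Lemma le_sup_norm phi (f : elt A) : Q phi -> normc (phi f) <= sup_norm f.
Proof.
move=> Qphi; apply: sup_upper_bound; last by exists phi.
split; first by exists (normc (phi f)), phi.
have [psi _ H] := compact_max cQ Q0 (normc_char_continuous (f := f)).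
by exists (normc (psi f)) => _ [p Qp <-]; exact: H.
Qed.

Lemma sup_norm_le (f : elt A) c : (forall phi, Q phi -> normc (phi f) <= c) -> sup_norm f <= c.
Proof.
move=> H; apply: ge_sup; first by have [p Qp] := Q0; exists (normc (p f)), p.
by move=> _ [p Qp <-]; exact: H.
Qed.

Lemma sup_norm_seminorm : is_seminorm elt_scalar sup_norm.
Proof.
have [p0 Qp0] := Q0.
split.
- by move=> f; apply: le_trans (le_sup_norm f Qp0); exact: normc_ge0.
- move=> f g; apply: sup_norm_le => p Qp; rewrite characterD.
  by apply: le_trans (le_normcD _ _) _; apply: lerD; exact: le_sup_norm.
- move=> f g; apply: sup_norm_le => p Qp; rewrite characterM normcM.
  by apply: ler_pM; rewrite ?normc_ge0//; exact: le_sup_norm.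
- move=> c; apply: sup_norm_le => p Qp.
  by rewrite /elt_scalar characterZ character1 mulr1.
- by apply: le_trans (le_sup_norm 1 Qp0); rewrite character1 normc1.
Qed.

Lemma char_sup_norm phi : Q phi -> contractive_char elt_scalar sup_norm phi.
Proof.
move=> Qphi; split; [exact: characterD|exact: characterM| |by move=> f; exact: le_sup_norm].
by move=> c; rewrite /elt_scalar characterZ character1 mulr1.
Qed.

Lemma contractive_char_character psi : contractive_char elt_scalar sup_norm psi ->
  exists phi : Phi, forall f, phi f = psi f.
Proof.
move=> H.
have psi1 : psi 1 = 1 by rewrite -(char_scalar H 1) (rmorph1 elt_scalar).
have lin : linear (psi : elt A -> R[i]^o).
  move=> a f g; rewrite -[RHS]/(a * psi f + psi g) -{2}(char_scalar H a) -(charM H) -(charD H).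
  congr psi; apply: (@elt_ext _ _ A) => x.
  by rewrite -[RHS]/(a * 1 * f x + g x) -[LHS]/(a * f x + g x) mulr1.
have mon : monoid_morphism (psi : elt A -> R[i]^o).
  by split=> // f g; exact: (charM H).
by exists (Character lin mon).
Qed.

End NonTrivial.

(** * Zeros in polyhedra *)

Section Polyhedron.
Context {R : realType} {X : topologicalType} (A : uniformAlgebra R X) (x0 : X).
Local Notation Phi := (character A).
Hypothesis Phi_compact : compact [set: Phi].
Hypothesis dense_inv : dense_invertibles A.
Variable G : set Phi.
Hypothesis G_closed : closed G.
Hypothesis G_norming : forall (f : elt A) (phi : Phi),
  exists2 g, G g & normc (phi f) <= normc (g f).

Definition polyhedron (fs : seq (elt A)) : set Phi :=
  [set phi | forall f, f \in fs -> normc (phi f) <= 2].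

Lemma closed_char_le f (c : R) : closed [set phi : Phi | normc (phi f) <= c].
Proof. by have /continuous_closedP/(_ _ (@closed_le _ c)) := @normc_char_continuous _ _ A f. Qed.

Lemma closed_char_ge f (c : R) : closed [set phi : Phi | c <= normc (phi f)].
Proof. by have /continuous_closedP/(_ _ (@closed_ge _ c)) := @normc_char_continuous _ _ A f. Qed.

Lemma polyhedron_closed fs : closed (polyhedron fs).
Proof.
rewrite (_ : polyhedron fs = \bigcap_(f in [set` fs]) [set phi | normc (phi f) <= 2]).
  by apply: closed_bigI => f _; exact: closed_char_le.
by apply/seteqP; split=> phi H f /H.
Qed.

Lemma closed_has_ge (fs : seq (elt A)) (c : R) :
  closed [set phi : Phi | exists2 f, f \in fs & c <= normc (phi f)].
Proof.
elim: fs => [|f fs IH].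
  by rewrite (_ : mkset _ = set0); [exact: closed0|apply/seteqP; split=> // phi []].
rewrite (_ : mkset _ = [set phi : Phi | c <= normc (phi f)] `|`
   [set phi : Phi | exists2 f, f \in fs & c <= normc (phi f)]).
  by apply: closedU => //; exact: closed_char_ge.
apply/seteqP; split=> phi /=.
  by move=> [g]; rewrite inE => /orP[/eqP -> ?|gs ?]; [left|right; exists g].
by move=> [?|[g gs ?]]; [exists f|exists g]; rewrite ?inE ?eqxx ?gs ?orbT.
Qed.

Lemma char_lower_bound (S : set Phi) (k : elt A) : closed S ->
  (forall phi, S phi -> phi k <> 0) ->
  exists2 c, 0 < c & forall phi, S phi -> c <= normc (phi k).
Proof.
move=> clS Sk; have [S0|S0] := pselect (S !=set0); last first.
  by exists 1 => // phi Sphi; exfalso; apply: S0; exists phi.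
have [|phi Sphi H] := compact_max (closed_compact Phi_compact clS) S0
    (g := fun phi : Phi => - normc (phi k)).
  by move=> p; have c := @normc_char_continuous _ _ A k p; exact: (cvgN c).
exists (normc (phi k)) => [|psi Spsi]; last by rewrite -lerN2; exact: H.
by rewrite normc_gt0; apply/eqP; exact: Sk.
Qed.

Lemma dense_invertibles_char (k : elt A) (e : R) : 0 < e ->
  exists g h : elt A, g * h = 1 /\ forall phi : Phi, normc (phi (g - k)) <= e.
Proof.
move=> e0; have [g [h [gh H]]] := dense_invertiblesP dense_inv k e0.
exists g, h; split=> // phi; apply: (char_contractive x0) => x.
by rewrite -normcN -[X in normc (- X)]/(g x - k x) opprB ltW.
Qed.

Lemma char_invertible (g h : elt A) (phi : Phi) : g * h = 1 ->
  phi g != 0 /\ phi h = (phi g)^-1.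
Proof.
move=> gh; have E : phi g * phi h = 1 by rewrite -characterM gh character1.
have g0 : phi g != 0.
  by apply/eqP => g0; move/eqP: E; rewrite g0 mul0r eq_sym oner_eq0.
by split=> //; apply: (mulfI g0); rewrite E divff.
Qed.

(** If [|k| >= c] on [G], an invertible [g] within [c/4] of [k] has [|1/g| <= 4/(3c)] on [G] but
    [|1/g| >= 4/c] at [phi], so [G] would not norm [1/g]. *)
Lemma norming_zero (k : elt A) (phi : Phi) : phi k = 0 -> exists2 z, G z & z k = 0.
Proof.
move=> phik; apply: contrapT => nz.
have [|c c0 Hc] := char_lower_bound (k := k) G_closed.
  by move=> z Gz zk; apply: nz; exists z.
have [|g [h [gh Hg]]] := dense_invertibles_char k (e := c / 4); first by rewrite divr_gt0.
have [z Gz] := G_norming h phi.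
have [zg ->] := char_invertible z gh; have [pg ->] := char_invertible phi gh.
have npg : 0 < normc (phi g) by rewrite normc_gt0.
have pgc : normc (phi g) <= c / 4 by have := Hg phi; rewrite characterB phik subr0.
have zgc : 3 * (c / 4) <= normc (z g).
  have := Hg z; have := Hc z Gz; rewrite characterB.
  by have := normcB_le (z g) (z k); rewrite ler_norml => /andP[]; lra.
rewrite !normcV lef_pV2 ?posrE//; lra.
Qed.

(** In the induction step [b = v / g] differs from [1/g] by at most [M + 1] where [|f| <= 2], and is
    at most [M + 1] where [|f| >= 1]. The induction hypothesis for [b - b(phi)] carries the huge
    value [b(phi)] to a point where [b] is moderate. *)
Lemma polyhedron_zero (fs : seq (elt A)) (k : elt A) (phi : Phi) :
  polyhedron fs phi -> phi k = 0 ->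
  exists z, [/\ polyhedron fs z, z k = 0 & G z \/ exists2 f, f \in fs & 1 <= normc (z f)].
Proof.
elim: fs k phi => [|f fs IH] k phi.
  by move=> _ /norming_zero[z Gz zk]; exists z; split=> //; left.
move=> Pphi phik; apply: contrapT => nz.
have Pfs z : polyhedron (f :: fs) z <-> normc (z f) <= 2 /\ polyhedron fs z.
  split=> [H|[H1 H2] g]; last by rewrite inE => /orP[/eqP ->|/H2].
  by split=> [|g gs]; apply: H; rewrite inE ?eqxx// gs orbT.
have [phif Qphi] := (Pfs _).1 Pphi.
pose Q := polyhedron fs; have Q0 : Q !=set0 by exists phi.
have cQ : compact Q by apply: (closed_compact Phi_compact); exact: polyhedron_closed.
have Hq := sup_norm_seminorm x0 cQ Q0.
have [|M [t [M0 t0 HM]]] := additive_Cousin Hq (k := k) (f := f).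
  move=> psi Hpsi psik /andP[f1 f2].
  have [z zpsi] := contractive_char_character Hpsi.
  (* A character bounded by the supremum over a polyhedron satisfies the inequalities that define
     it. *)
  have Qz : Q z.
    move=> g gs; rewrite zpsi; apply: le_trans (char_le Hpsi g) _.
    by apply: sup_norm_le => // p Qp; exact: Qp.
  apply: nz; exists z; split.
  - by apply/Pfs; rewrite zpsi.
  - by rewrite zpsi.
  - by right; exists f; rewrite ?inE ?eqxx// zpsi.
(* The places with [|f| <= 2] where the induction hypothesis can put a point; [k] has no zero there
   by assumption. *)
pose S := polyhedron (f :: fs) `&` (G `|` [set z | exists2 f, f \in fs & 1 <= normc (z f)]).
have [||c c0 Hc] := @char_lower_bound S k.
- apply: closedI; first exact: polyhedron_closed.
  by apply: closedU => //; exact: closed_has_ge.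
- move=> z [Pz Hz] zk; apply: nz; exists z; split=> //.
  by case: Hz => [?|[g gs ?]]; [left|right; exists g => //; rewrite inE gs orbT].
(* A lower bound for [|1/g|] at [phi]; it makes [|b(phi)|] at least [2/c + M + 2], above the bound
   [2/c + M + 1] obtained at [z]. *)
pose B := 2 / c + 2 * M + 3.
have c2 : 0 < 2 / c by rewrite divr_gt0.
have B0 : 0 < B by rewrite /B; lra.
pose e0 := Num.min t (Num.min (c / 2) B^-1).
have [|g [h [gh Hg]]] := dense_invertibles_char k (e := e0).
  by rewrite !lt_min t0 divr_gt0// invr_gt0.
have e0t : e0 <= t by rewrite ge_min lexx.
have e0c : e0 <= c / 2 by rewrite !ge_min lexx orbT.
have e0B : e0 <= B^-1 by rewrite !ge_min lexx !orbT.
have gkt : sup_norm (x0 := x0) Q (g - k : elt A) <= t.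
  by apply: (sup_norm_le x0 Q0) => p _; exact: le_trans (Hg p) e0t.
(* The error is chosen after [g], so that its product with [h = 1/g] is at most 1. *)
pose d := (sup_norm (x0 := x0) Q h + 1)^-1.
have h0 : 0 <= sup_norm (x0 := x0) Q h := seminorm_ge0 Hq h.
have d0 : 0 < d by rewrite invr_gt0; lra.
have [v Hv] := HM g gkt d d0.
pose b : elt A := (v : elt A) * h.
have err z (w : R[i]) : Q z -> normc w <= d -> normc (w * z h) <= 1.
  move=> Qz wd; rewrite normcM.
  have zh : normc (z h) <= sup_norm (x0 := x0) Q h by exact: le_sup_norm.
  apply: (@le_trans _ _ (d * (sup_norm (x0 := x0) Q h + 1))).
    by apply: ler_pM; rewrite ?normc_ge0//; lra.
  by rewrite /d mulVf// gt_eqF// ltr_wpDl.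
have inside z : Q z -> normc (z f) <= 2 -> exists2 u, normc u <= M + 1 & z b = (z g)^-1 - u.
  move=> Qz zf; have [zg zh] := char_invertible z gh.
  have [/(_ zf)[u uM uv] _] := Hv z (char_sup_norm x0 cQ Q0 Qz).
  exists (u - (z v - (1 - u * z g)) * z h).
    apply: le_trans (le_normcD _ _) _; rewrite normcN.
    by have := err z _ Qz uv; lra.
  by rewrite /b characterM zh; field.
have outside z : Q z -> 1 <= normc (z f) -> normc (z b) <= M + 1.
  move=> Qz zf; have [zg zh] := char_invertible z gh.
  have [_ /(_ zf)[u uM uv]] := Hv z (char_sup_norm x0 cQ Q0 Qz).
  have -> : z b = u + (z v - u * z g) * z h by rewrite /b characterM zh; field.
  by apply: le_trans (le_normcD _ _) _; have := err z _ Qz uv; lra.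
have phib0 : phi (b - (phi b : R[i]) *: (1 : elt A)) = 0.
  by rewrite characterB characterZ character1 mulr1 subrr.
have [z [Qz zb Hz]] := IH _ phi Qphi phib0.
have {}zb : z b = phi b by apply: subr0_eq; rewrite -zb characterB characterZ character1 mulr1.
have small : normc (z b) <= 2 / c + M + 1.
  have [zf|/ltW zf] := lerP (normc (z f)) 2; last first.
    by have := outside z Qz (le_trans _ zf); rewrite ler1n => /(_ isT); lra.
  have [u uM ->] := inside z Qz zf.
  have Sz : S z by split=> //; apply/Pfs.
  have zg : c / 2 <= normc (z g).
    have := Hg z; have := Hc z Sz; rewrite characterB.
    by have := normcB_le (z g) (z k); rewrite ler_norml => /andP[]; lra.
  have zg' : normc (z g)^-1 <= 2 / c.
    by rewrite normcV -[2 / c]invrK lef_pV2 ?posrE ?invf_div//; lra.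
  by apply: le_trans (le_normcD _ _) _; rewrite normcN; lra.
have [u uM phib] := inside phi Qphi phif.
have [pg _] := char_invertible phi gh.
have npg : 0 < normc (phi g) by rewrite normc_gt0.
have large : B <= normc (phi g)^-1.
  rewrite normcV -[B]invrK lef_pV2 ?posrE ?invr_gt0//.
  by have := Hg phi; rewrite characterB phik subr0; lra.
have := le_normcD ((phi g)^-1 - u) u; rewrite subrK -phib -zb.
by move: large; rewrite /B; lra.
Qed.

End Polyhedron.

(** * Quasi-components of compact spaces *)

Section QuasiComponent.
Context (R : realType) {T : topologicalType}.
Hypothesis T_compact : compact [set: T].
Hypothesis T_hausdorff : hausdorff_space T.

Lemma closed_separate (E F : set T) : closed E -> closed F -> E `&` F = set0 ->
  exists U V, [/\ open U, open V, E `<=` U, F `<=` V & U `&` V = set0].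
Proof.
exact: ((@normal_openP R T).1 (compact_normal T_hausdorff T_compact) E F).
Qed.

Variables (Z : set T) (p : T).
Hypotheses (Z_closed : closed Z) (Zp : Z p).

Definition clopen_part E := [/\ E p, closed E, E `<=` Z & closed (Z `\` E)].

Definition quasi_component := \bigcap_(E in clopen_part) E.

Lemma clopen_partZ : clopen_part Z.
Proof. by split=> //; rewrite setDv; exact: closed0. Qed.

Lemma clopen_partI E F : clopen_part E -> clopen_part F -> clopen_part (E `&` F).
Proof.
move=> [Ep clE EZ clE'] [Fp clF FZ clF']; split=> //; first exact: closedI.
  by move=> x [/EZ].
by rewrite setDIr; exact: closedU.
Qed.

(** The complements of the clopen parts cover the compact set [S], and finite intersections of
    clopen parts are clopen parts. *)
Lemma clopen_part_avoid (S : set T) : closed S -> S `&` quasi_component = set0 ->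
  exists2 E, clopen_part E & E `&` S = set0.
Proof.
move=> clS SQ.
have [|s sP Hs] := @compact_finite_cover T (set T) S clopen_part (fun E => ~` E)
  (closed_compact T_compact clS).
  move=> x Sx; have [E PE nEx] : exists2 E, clopen_part E & ~ E x.
    apply: contrapT => H; suff : (S `&` quasi_component) x by rewrite SQ.
    by split=> // E PE; apply: contrapT => nEx; apply: H; exists E.
  exists E => //; apply: open_nbhs_nbhs; split=> //; apply: closed_openC.
  by case: PE.
have [E PE HE] : exists2 E, clopen_part E & forall F, F \in s -> E `<=` F.
  elim: s sP {Hs} => [|F s IH] sP; first by exists Z => //; exact: clopen_partZ.
  have [|E PE HE] := IH; first by move=> G Gs; apply: sP; rewrite inE Gs orbT.
  exists (E `&` F); first by apply: clopen_partI => //; apply: sP; rewrite inE eqxx.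
  move=> G; rewrite inE => /orP[/eqP -> x []//|Gs x [Ex _]]; exact: (HE G Gs).
exists E => //; apply/seteqP; split=> // x [Ex /Hs[F Fs]]; apply; exact: (HE F Fs).
Qed.

Lemma quasi_component_closed : closed quasi_component.
Proof. by apply: closed_bigI => E []. Qed.

(** Separate [C] and [D] by disjoint open [U] and [V]. Some clopen part [E] lies in their union, and
    [E \ V] is then a clopen part that excludes [D]. *)
Lemma quasi_component_split (C D : set T) : closed C -> closed D -> C `&` D = set0 ->
  C `|` D = quasi_component -> C p -> D = set0.
Proof.
move=> clC clD CD CDQ Cp.
have [U [V [oU oV CU DV UV]]] := closed_separate clC clD CD.
have [||E [Ep clE EZ clE'] EUV] := @clopen_part_avoid (~` (U `|` V)).
- by apply: open_closedC; exact: openU.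
- apply/seteqP; split=> // x [nUV]; rewrite -CDQ => -[/CU Ux|/DV Vx]; apply: nUV.
    by left.
  by right.
have EUV' x : E x -> U x \/ V x.
  move=> Ex; apply: contrapT => nUV.
  suff : (E `&` ~` (U `|` V)) x by rewrite EUV.
  by split.
have disj x : U x -> V x -> False.
  by move=> Ux Vx; suff : (U `&` V) x by rewrite UV.
have PEU : clopen_part (E `\` V).
  split.
  - by split=> // Vp; apply: (disj p) => //; exact: CU.
  - by rewrite setDE; apply: closedI => //; exact: open_closedC.
  - by move=> x [/EZ].
  - have -> : Z `\` (E `\` V) = (Z `\` E) `|` (E `\` U).
      apply/seteqP; split=> x.
        move=> [Zx nEV]; have [Ex|] := pselect (E x); last by left.
        right; split=> // Ux; apply: nEV; split=> // Vx; exact: (disj x).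
      move=> [[Zx nEx]|[Ex nUx]]; first by split=> // -[].
      by split; [exact: EZ|move=> [_]; apply; have [] := EUV' x Ex].
    apply: closedU => //; rewrite setDE; apply: closedI => //; exact: open_closedC.
apply/seteqP; split=> // x Dx.
have Qx : quasi_component x by rewrite -CDQ; right.
by have [_] := Qx _ PEU; apply; exact: DV.
Qed.

Lemma quasi_component_connected : connected quasi_component.
Proof.
have Qp : quasi_component p by move=> E [].
move=> B [b Bb] [O oO BO] [C clC BC].
have clB : closed B by rewrite BC; apply: closedI => //; exact: quasi_component_closed.
have BQ : B `<=` quasi_component by rewrite BC => x [].
have clD : closed (quasi_component `\` B).
  have -> : quasi_component `\` B = quasi_component `&` ~` O.
    rewrite BO setDE setCI setIUr setICr set0U //.
  by apply: closedI; [exact: quasi_component_closed|exact: open_closedC].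
have [Bp|nBp] := pselect (B p).
  have D0 : quasi_component `\` B = set0.
    apply: (quasi_component_split clB clD) => //.
      by apply/seteqP; split=> // x [Bx [_]].
    apply/seteqP; split=> x; first by move=> [/BQ|[]].
    by move=> Qx; have [|] := pselect (B x); [left|right].
  apply/seteqP; split=> // x Qx; apply: contrapT => nBx.
  by suff : (quasi_component `\` B) x by rewrite D0.
have B0 : B = set0.
  apply: (quasi_component_split clD clB) => //; first by apply/seteqP; split=> // x [[]].
  apply/seteqP; split=> x; first by move=> [[]//|/BQ].
  by move=> Qx; have [|] := pselect (B x); [right|left].
by exfalso; rewrite B0 in Bb.
Qed.

(** The quasi-component is connected, hence inside the component, so it misses [S] as well. *)
Lemma component_clopen_part (S : set T) : closed S ->
  connected_component Z p `&` S = set0 ->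
  exists2 E, clopen_part E & E `&` S = set0.
Proof.
move=> clS KS; apply: clopen_part_avoid => //; apply/seteqP; split=> // x [Sx Qx].
suff : (connected_component Z p `&` S) x by rewrite KS.
split=> //; apply: (@connected_component_max _ Z quasi_component p) => //.
- by move=> E [].
- by move=> y; apply; exact: clopen_partZ.
- exact: quasi_component_connected.
Qed.

End QuasiComponent.

(** * The Shilov boundary *)

Section Shilov.
Context {R : realType} {X : topologicalType} (A : uniformAlgebra R X).
Hypothesis X_compact : compact [set: X].

Lemma normc_elt_continuous (f : elt A) : continuous (fun x => normc (val f x)).
Proof.
move=> x; apply: (@continuous_comp X R[i]^o R (val f)); last exact: normc_continuous.
exact: (ua_continuous (set_mem (elt_mem f))).
Qed.

Lemma elt_sep (x y : X) : x <> y -> exists2 f : elt A, val f y = 0 & 2 < normc (val f x).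
Proof.
move=> xy; apply: (@char_sep _ _ A (ev A x) (ev A y)) => exy.
have [f Af] := ua_separates A xy; apply.
exact: (congr1 (fun phi : character A => phi (Elt (mem_set Af))) exy).
Qed.

Lemma boundary_attained (K : set X) : K !=set0 -> closed K ->
  (forall f : elt A, sup [set normc (val f x) | x in K] = sup [set normc (val f x) | x in setT]) <->
  (forall (f : elt A) x, exists2 k, K k & normc (val f x) <= normc (val f k)).
Proof.
move=> K0 clK; have cK : compact K by exact: closed_compact X_compact clK.
have [x0 _] := K0.
split=> [H f x|H f].
  have [k Kk Hk] := compact_max cK K0 (normc_elt_continuous (f := f)).
  exists k => //; apply: (@le_trans _ _ (sup [set normc (val f x) | x in K])).
    rewrite H; apply: sup_upper_bound; last by exists x.
    split; first by exists (normc (val f x)), x.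
    have [y _ Hy] := compact_max X_compact (ex_intro _ x0 I) (normc_elt_continuous (f := f)).
    by exists (normc (val f y)) => _ [z _ <-]; exact: Hy.
  by apply: ge_sup; [exists (normc (val f k)), k|move=> _ [z Kz <-]; exact: Hk].
have [y _ Hy] := compact_max X_compact (ex_intro _ x0 I) (normc_elt_continuous (f := f)).
have [k Kk yk] := H f y.
have sup_eq (S : set X) : S k -> sup [set normc (val f x) | x in S] = normc (val f k).
  move=> Sk; apply/eqP; rewrite eq_le; apply/andP; split.
    apply: ge_sup; first by exists (normc (val f k)), k.
    by move=> _ [z _ <-]; exact: le_trans (Hy z I) yk.
  apply: sup_upper_bound; last by exists k.
  split; first by exists (normc (val f k)), k.
  by exists (normc (val f k)) => _ [z _ <-]; exact: le_trans (Hy z I) yk.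
by rewrite !sup_eq.
Qed.

(** A minimal boundary is the least one because [A] separates points; this existence keeps [get]
    from its default value [set0]. *)
Lemma shilov_boundaryP : [set: X] !=set0 ->
  closed (shilov_boundary A) /\ forall (f : elt A) x,
    exists2 k, shilov_boundary A k & normc (val f x) <= normc (val f k).
Proof.
move=> [x0 _].
have vc f : continuous (fun x => normc (val (f : elt A) x)) by exact: normc_elt_continuous.
have [K mK] := exists_minimal_boundary (v := fun x (f : elt A) => val f x) vc X_compact closedT.
have [[clK _ bK] _] := mK.
have K0 : K !=set0 by have [k Kk _] := bK 1 x0 I; exists k.
suff /getPex[[S0 clS supS] _] : exists K, is_boundary A K /\ forall L, is_boundary A L -> K `<=` L.
  by split=> //; apply/boundary_attained.
exists K; split.
  by split=> //; apply/boundary_attained => // f x; exact: bK.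
move=> B [B0 clB supB].
apply: (minimal_boundary_least _ _ vc elt_sep X_compact mK) => //.
split=> // f x _; exact: ((boundary_attained B0 clB).1 supB).
Qed.

End Shilov.

(** * Components of zero sets and the Shilov boundary *)

Theorem theorem1p2 (R : realType) (X : topologicalType)
    (X_nonempty : [set: X] !=set0)
    (X_compact : compact [set: X])
    (X_hausdorff : hausdorff_space X)
    (A : uniformAlgebra R X)
    (Phi_compact : compact [set: character A])
    (A_dense_invertibles : dense_invertibles A)
    (f : elt A)
    (Zf_nonempty : zero_set f !=set0)
    (K : set (character A))
    (K_component : (connected_component (zero_set f) @` zero_set f) K) :
  K `&` (ev A @` shilov_boundary A) !=set0.
Proof.
have [x0 _] := X_nonempty.
have [clS normS] := shilov_boundaryP A X_compact X_nonempty.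
set S := shilov_boundary A in clS normS *; pose G : set (character A) := ev A @` S.
have hPhi := @char_hausdorff _ _ A.
have cS : compact S by exact: closed_compact X_compact clS.
have clG : closed G.
  apply: compact_closed => //; apply: continuous_compact => //.
  by apply: continuous_subspaceT; exact: ev_continuous.
(* Contractivity of characters extends the norming property from [X] to the whole maximal ideal
   space. *)
have normG (h : elt A) (phi : character A) : exists2 g, G g & normc (phi h) <= normc (g h).
  have S0 : S !=set0 by have [s Ss _] := normS 1 x0; exists s.
  have [s Ss Hs] := compact_max cS S0 (normc_elt_continuous (f := h)).
  exists (ev A s); first by exists s.
  apply: (char_contractive x0) => x; have [k Sk xk] := normS h x.
  exact: le_trans xk (Hs k Sk).
have [p Zp KE] := K_component.
apply: contrapT => nK.
have clZ : closed (zero_set f).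
  have -> : zero_set f = [set phi : character A | normc (phi f) <= 0].
    apply/seteqP; split=> phi /=; rewrite /zero_set /=; first by move=> ->; rewrite normc0.
    move=> H; apply: eq0_normc; apply/eqP; rewrite eq_le H; exact: normc_ge0.
  exact: closed_char_le.
have [|E [Ep clE EZ clZE] EG] := component_clopen_part R Phi_compact hPhi clZ Zp clG.
  apply/seteqP; split=> // phi [Kphi Gphi]; apply: nK; exists phi; split=> //.
  by rewrite -KE.
have [||O [V [oO oV EO FV OV]]] :=
  closed_separate R Phi_compact hPhi (E := E) (F := (zero_set f `\` E) `|` G) clE.
- exact: closedU.
- apply/seteqP; split=> // phi [Ephi [[_ nE]|Gphi]]; first exact: (nE Ephi).
  by suff : (E `&` G) phi by rewrite EG.
pose T := closure O; have clT : closed T by exact: closed_closure.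
have OT : O `<=` T by exact: subset_closure.
have TV phi : T phi -> ~ V phi.
  move=> Tphi Vphi; have [psi [Opsi Vpsi]] := Tphi V (open_nbhs_nbhs (conj oV Vphi)).
  by suff : (O `&` V) psi by rewrite OV.
have cT : compact T by exact: closed_compact Phi_compact clT.
(* Zeros of [f] in [T] lie in [E], as [V] contains the others. With [g] within [d/3] of [f], [|g|]
   is at least [2d/3] on [T \ O] and at most [d/3] at [p]. *)
have [||d d0 Hd] := @char_lower_bound _ _ A Phi_compact (T `\` O) f.
- by rewrite setDE; apply: closedI => //; exact: open_closedC.
- move=> phi [Tphi nO] phif; have [Ephi|nE] := pselect (E phi); first by apply: nO; exact: EO.
  by apply: (TV phi) => //; apply: FV; left.
have [|g [h [gh Hg]]] := dense_invertibles_char x0 A_dense_invertibles f (e := d / 3).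
  by rewrite divr_gt0.
have vM (phi : character A) a b : phi (a * b) = phi a * phi b by exact: characterM.
have v1 (phi : character A) : phi 1 = 1 by exact: character1.
have vc a : continuous (fun phi : character A => normc (phi a)) by exact: normc_char_continuous.
have [B mB] := exists_minimal_boundary (v := fun (phi : character A) (a : elt A) => phi a)
  vc cT clT.
have [[clB BT bB] _] := mB.
have [y By Oy] : exists2 y, B y & O y.
  have [y By py] := bB h p (OT _ (EO _ Ep)); exists y => //; apply: contrapT => nOy.
  have [yg yh] := char_invertible y gh; have [pg ph] := char_invertible p gh.
  move: py; rewrite yh ph !normcV; apply/negP; rewrite -ltNge.
  have yd : d <= normc (y f) by apply: Hd; split=> //; exact: BT.
  have yg' : 2 * (d / 3) <= normc (y g).
    have := Hg y; rewrite characterB; have := normcB_le (y g) (y f).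
    by rewrite ler_norml => /andP[]; lra.
  have pg' : normc (p g) <= d / 3 by have := Hg p; rewrite characterB Zp subr0.
  have npg : 0 < normc (p g) by rewrite normc_gt0.
  by rewrite ltf_pV2 ?posrE//; lra.
(* Functions vanishing at [y], one of which exceeds 2 in modulus at each point outside [O]: their
   polyhedron lies in [O]. *)
have [|fs fs0 Hfs] := @compact_finite_cover (character A) (elt A) (~` O) (fun a => y a = 0)
    (fun a => [set phi | 2 < normc (phi a)]) (closed_compact Phi_compact (open_closedC oO)).
  move=> phi nO; have [|a ya phia] := @char_sep _ _ A phi y.
    by move=> py; apply: nO; rewrite py.
  exists a => //; apply: open_nbhs_nbhs; split=> //.
  by have /continuousP/(_ _ (@open_gt _ 2)) := @vc a.
have fsO : polyhedron fs `<=` O.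
  move=> phi Pphi; apply: contrapT => /Hfs[a afs /=]; rewrite ltNge => /negP; apply.
  exact: Pphi.
have [|a [x1 [Tx1 max1 peak]]] := minimal_boundary_peak vM v1 vc cT mB By (fs := fs).
  by move=> a /fs0 ->; rewrite normc0.
have Px1 : polyhedron fs x1.
  by move=> b bfs; have := peak x1 Tx1 (lexx _) b bfs; lra.
have k0 : x1 (a - (x1 a : R[i]) *: (1 : elt A)) = 0.
  by rewrite characterB characterZ character1 mulr1 subrr.
have [z [Pz zk zGf]] := polyhedron_zero x0 Phi_compact A_dense_invertibles clG normG Px1 k0.
have za : z a = x1 a by apply: subr0_eq; rewrite -zk characterB characterZ character1 mulr1.
have Oz := fsO z Pz.
(* Both alternatives fail: [G] lies in [V], which [T] avoids, and [z] is a maximum point of [|a|]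
   over [T], where all the [f_i] have modulus below 1. *)
case: zGf => [Gz|[b bfs zb]].
  by apply: (TV z (OT _ Oz)); apply: FV; right.
have := peak z (OT _ Oz); rewrite za lexx => /(_ isT b bfs); lra.
Qed.
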